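(* Let $\nu>0$ be fixed with $\nu\ne2$. Consider the numerical method $$\begin{pmatrix}P_{n+1}\\Q_{n+1}\end{pmatrix}=A(h)\begin{pmatrix}P_n\\Q_n\end{pmatrix}+\sqrt\epsilon\,b(h)\,\Delta W_n,\quad n=0,1,2,\dots,$$ with step-size $h>0$, where $A=(a_{ij})_{i,j=1,2}$ and $b=(b_1,b_2)^\top$ satisfy, as $h\to0$, $$|a_{11}-1+\nu h|+|a_{12}+h|+|a_{21}-h|+|a_{22}-1|=\mathcal O(h^2),\qquad |b_1-1|+|b_2|=\mathcal O(h).$$ Then for all sufficiently small $h>0$ and any $\epsilon>0$, the numerical solution $\{(P_n,Q_n)\}_{n\ge0}$ possesses a unique invariant measure $\mu^h_{\nu,\epsilon}=\mathcal N(0,\Sigma)$ with $$\Sigma=\frac{\epsilon h}{(\lambda_2-\lambda_1)^2}\begin{pmatrix}\Sigma_{11}&\Sigma_{12}\\\Sigma_{21}&\Sigma_{22}\end{pmatrix},$$ where $\lambda_{1,2}=\frac12\big(\mathrm{tr}(A)\pm\sqrt{(\mathrm{tr}(A))^2-4\det(A)}\big)$ are the eigenvalues of $A$ and $$\Sigma_{11}=\tfrac{(a_{12}b_2+b_1(a_{11}-\lambda_2))^2}{1-\lambda_1^2}+\tfrac{(a_{12}b_2+b_1(a_{11}-\lambda_1))^2}{1-\lambda_2^2}+\tfrac{2a_{12}a_{21}b_1^2-2a_{12}^2b_2^2+2a_{12}b_1b_2(a_{22}-a_{11})}{1-\lambda_1\lambda_2},$$ $$\Sigma_{22}=\tfrac{(a_{21}b_1+b_2(\lambda_1-a_{11}))^2}{1-\lambda_1^2}+\tfrac{(a_{21}b_1+b_2(\lambda_2-a_{11}))^2}{1-\lambda_2^2}+\tfrac{2a_{12}a_{21}b_2^2-2a_{21}^2b_1^2-2a_{21}b_1b_2(a_{22}-a_{11})}{1-\lambda_1\lambda_2},$$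 $$\Sigma_{12}=\Sigma_{21}=\tfrac{a_{21}(a_{11}-\lambda_2)b_1^2+a_{12}(\lambda_1-a_{11})b_2^2+2a_{12}a_{21}b_1b_2}{1-\lambda_1^2}+\tfrac{a_{21}(a_{11}-\lambda_1)b_1^2+a_{12}(\lambda_2-a_{11})b_2^2+2a_{12}a_{21}b_1b_2}{1-\lambda_2^2}+\tfrac{(a_{22}-a_{11})(a_{21}b_1^2-a_{12}b_2^2+b_1b_2(a_{22}-a_{11}))}{1-\lambda_1\lambda_2}.$$
   Context: $W$ is a one-dimensional standard Wiener process, $t_n=nh$, $\Delta W_n=W(t_{n+1})-W(t_n)$, and the initial value $(P_0,Q_0)=(p,q)\in\mathbb R^2$ is deterministic. The entries $a_{ij},b_i:(0,\infty)\to\mathbb R$ are functions of $h$ which may depend on $\nu$ but not on $\epsilon$; the argument $h$ is omitted. (The method approximates the Langevin equation $dP=-Q\,dt-\nu P\,dt+\sqrt\epsilon\,dW$, $dQ=P\,dt$.) $f(h)=\mathcal O(h^p)$ means $|f(h)|\le Ch^p$ for all sufficiently small $h>0$ with $C>0$ independent of $h$. The eigenvalues $\lambda_{1,2}$ may be complex. A probability measure $\mu$ on $\mathbb R^2$ is invariant for the Markov chain $\{(P_n,Q_n)\}$ if $\int \mathbf E[\varphi(P_n,Q_n)\mid (P_0,Q_0)=x]\,\mu(dx)=\int\varphi\,d\mu$ for all bounded continuous $\varphi$ and all $n$. $\mathcal N(0,\Sigma)$ is the Gaussian law on $\mathbb R^2$ with mean zero and covariance $\Sigma$. *)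

(* Defs.v *)
From HB Require Import structures.
From mathcomp Require Import all_boot all_order all_algebra.
From mathcomp Require Import all_classical all_reals all_analysis.
From mathcomp Require Import complex ring.

Set Implicit Arguments.
Unset Strict Implicit.
Unset Printing Implicit Defensive.

Import Order.TTheory GRing.Theory Num.Theory.
Import numFieldNormedType.Exports.

Local Open Scope classical_set_scope.
Local Open Scope ring_scope.

(* Taking some of the [B i] equal to [setT] gives the product rule for every
   subfamily. *)
Definition mutually_independent d (T : measurableType d) (R : realType)
    (P : probability T R) (I : finType) (X : I -> T -> R) : Prop :=
  forall B : I -> set R, (forall i, measurable (B i)) ->
    P (\bigcap_i (X i @^-1` B i)) = (\prod_(i : I) P (X i @^-1` B i))%E.

(* The time set is [0, +oo[; the values of [W] at negative times are
   irrelevant.  [normal_prob] takes the standard deviation as its second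
   parameter. *)
Definition standard_wiener d (T : measurableType d) (R : realType)
    (P : probability T R) (W : R -> {RV P >-> R}) : Prop :=
  [/\ {ae P, forall w, W 0 w = 0},
      (forall s t : R, 0 <= s -> s < t -> forall B : set R, measurable B ->
         pushforward P (fun w => W t w - W s w) B
         = normal_prob 0 (Num.sqrt (t - s)) B),
      (forall (n : nat) (t : nat -> R), 0 <= t 0%N ->
         (forall i, t i <= t i.+1) ->
         mutually_independent P
           (fun (i : 'I_n) w => W (t i.+1) w - W (t i) w)) &
      {ae P, forall w, {within `[0, +oo[%classic, continuous (W ^~ w)}}].

Section method.
Context {R : realType}.

Definition col_of_pair (x : R * R) : 'cV[R]_2 :=
  \col_i (if i == 0 then x.1 else x.2).

Definition pair_of_col (X : 'cV[R]_2) : R * R := (X 0 0, X 1 0).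

Fixpoint method_col (A : 'M[R]_2) (b : 'cV[R]_2) (eps h : R) (path : R -> R)
    (x : R * R) (n : nat) : 'cV[R]_2 :=
  if n is m.+1 then
    A *m method_col A b eps h path x m
    + (Num.sqrt eps * (path (m.+1%:R * h) - path (m%:R * h))) *: b
  else col_of_pair x.

Definition method d (T : measurableType d) (W : R -> T -> R)
    (A : 'M[R]_2) (b : 'cV[R]_2) (eps h : R) (x : R * R) (n : nat) (w : T)
    : R * R :=
  pair_of_col (method_col A b eps h (W ^~ w) x n).

(* [X x n] is the state at time [n] of the chain started from the
   deterministic point [x], so that the conditional expectation given the
   initial value [x] is the plain expectation of [phi (X x n)]. *)
Definition invariant_measure d (T : measurableType d) (P : probability T R)
    (X : R * R -> nat -> T -> R * R)
    (mu : probability (R * R)%type R) : Prop :=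
  forall phi : R * R -> R, continuous phi -> bounded_fun phi ->
  forall n : nat,
    (\int[mu]_x 'E_P[fun w => phi (X x n w)] = \int[mu]_x (phi x)%:E)%E.

(* [s] is the standard deviation; [normal_prob m 0] is not the point mass
   at [m]. *)
Definition normal_law (m s : R) : set R -> \bar R :=
  if s == 0 then \d_m else normal_prob m s.

Definition gaussian2 (mu : probability (R * R)%type R) : Prop :=
  forall u v : R, exists m s : R, forall B : set R, measurable B ->
    pushforward mu (fun x : R * R => u * x.1 + v * x.2) B = normal_law m s B.

Definition centered_gaussian2 (S : 'M[R]_2)
    (mu : probability (R * R)%type R) : Prop :=
  [/\ gaussian2 mu,
      ('E_mu[fst] = 0 /\ 'E_mu[snd] = 0)%E,
      covariance mu fst fst = (S 0 0)%:E,
      covariance mu fst snd = (S 0 1)%:E /\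
      covariance mu snd fst = (S 1 0)%:E &
      covariance mu snd snd = (S 1 1)%:E].

End method.

Section formulas.
Context {C : numClosedFieldType}.
Implicit Types (A : 'M[C]_2) (b : 'cV[C]_2).

Definition lambda1 A : C := (\tr A + sqrtC (\tr A ^+ 2 - 4 * \det A)) / 2.

Definition lambda2 A : C := (\tr A - sqrtC (\tr A ^+ 2 - 4 * \det A)) / 2.

Lemma char_poly_lambda A :
  char_poly A = ('X - (lambda1 A)%:P) * ('X - (lambda2 A)%:P).
Proof.
have i1 (k : 'I_1) : lift ord0 k = 1 :> 'I_2 by apply/val_inj; rewrite (ord1 k).
have i0 (k : 'I_1) : lift 1 k = 0 :> 'I_2 by apply/val_inj; rewrite (ord1 k).
have det2 (K : comNzRingType) (M : 'M[K]_2) :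
    \det M = M 0 0 * M 1 1 - M 0 1 * M 1 0.
  rewrite (expand_det_row _ ord0) !big_ord_recl big_ord0 /cofactor !det_mx11.
  by rewrite !mxE !i1 !i0 expr0 expr1 mul1r mulN1r mulrN addr0.
have tE : \tr A = A 0 0 + A 1 1.
  by rewrite /mxtrace !big_ord_recl big_ord0 addr0 i1.
have sumE : lambda1 A + lambda2 A = \tr A by rewrite /lambda1 /lambda2; field.
have prodE : lambda1 A * lambda2 A = \det A.
  rewrite /lambda1 /lambda2; set s := sqrtC _.
  have -> : (\tr A + s) / 2 * ((\tr A - s) / 2) = (\tr A ^+ 2 - s ^+ 2) / 4.
    by field.
  by rewrite sqrtCK; field.
have vieta (K : comNzRingType) (x y z : K) :
    (x - y) * (x - z) = x * x - (y + z) * x + y * z by ring.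
rewrite vieta -polyCD -polyCM sumE prodE tE det2 /char_poly det2 !mxE /=.
rewrite mulr1n mulr0n !sub0r mulrNN vieta.
by rewrite polyCD polyCB !polyCM -addrA.
Qed.

Definition sigma11 A b : C :=
  let a11 := A 0 0 in let a12 := A 0 1 in
  let a21 := A 1 0 in let a22 := A 1 1 in
  let b1 := b 0 0 in let b2 := b 1 0 in
  let l1 := lambda1 A in let l2 := lambda2 A in
  (a12 * b2 + b1 * (a11 - l2)) ^+ 2 / (1 - l1 ^+ 2)
  + (a12 * b2 + b1 * (a11 - l1)) ^+ 2 / (1 - l2 ^+ 2)
  + (2 * a12 * a21 * b1 ^+ 2 - 2 * a12 ^+ 2 * b2 ^+ 2
     + 2 * a12 * b1 * b2 * (a22 - a11)) / (1 - l1 * l2).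

Definition sigma22 A b : C :=
  let a11 := A 0 0 in let a12 := A 0 1 in
  let a21 := A 1 0 in let a22 := A 1 1 in
  let b1 := b 0 0 in let b2 := b 1 0 in
  let l1 := lambda1 A in let l2 := lambda2 A in
  (a21 * b1 + b2 * (l1 - a11)) ^+ 2 / (1 - l1 ^+ 2)
  + (a21 * b1 + b2 * (l2 - a11)) ^+ 2 / (1 - l2 ^+ 2)
  + (2 * a12 * a21 * b2 ^+ 2 - 2 * a21 ^+ 2 * b1 ^+ 2
     - 2 * a21 * b1 * b2 * (a22 - a11)) / (1 - l1 * l2).

Definition sigma12 A b : C :=
  let a11 := A 0 0 in let a12 := A 0 1 in
  let a21 := A 1 0 in let a22 := A 1 1 in
  let b1 := b 0 0 in let b2 := b 1 0 in
  let l1 := lambda1 A in let l2 := lambda2 A in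
  (a21 * (a11 - l2) * b1 ^+ 2 + a12 * (l1 - a11) * b2 ^+ 2
   + 2 * a12 * a21 * b1 * b2) / (1 - l1 ^+ 2)
  + (a21 * (a11 - l1) * b1 ^+ 2 + a12 * (l2 - a11) * b2 ^+ 2
     + 2 * a12 * a21 * b1 * b2) / (1 - l2 ^+ 2)
  + (a22 - a11) * (a21 * b1 ^+ 2 - a12 * b2 ^+ 2 + b1 * b2 * (a22 - a11))
    / (1 - l1 * l2).

Definition sigma A b (eps h : C) : 'M[C]_2 :=
  (eps * h / (lambda2 A - lambda1 A) ^+ 2) *:
  \matrix_(i, j) (if i == j then if i == 0 then sigma11 A b else sigma22 A b
                  else sigma12 A b).

(* Division by zero is a total operation: this says that the denominators in
   [sigma] do not vanish. *)
Definition sigma_defined A : Prop :=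
  [/\ lambda2 A - lambda1 A != 0, 1 - lambda1 A ^+ 2 != 0,
      1 - lambda2 A ^+ 2 != 0 & 1 - lambda1 A * lambda2 A != 0].

End formulas.

(* Main.v *)
Require Import Defs.
From HB Require Import structures.
From mathcomp Require Import all_boot all_order all_algebra.
From mathcomp Require Import all_classical all_reals all_analysis.
From mathcomp Require Import measurable_realfun complex ring lra.

Import Order.TTheory GRing.Theory Num.Theory.
Import numFieldNormedType.Exports.

Local Open Scope classical_set_scope.
Local Open Scope ring_scope.
Local Open Scope complex_scope.

(** The state of the scheme after [n] steps is [A^n x] plus
    [\sum_(k < n) xi_(n-1-k) v_k], where [xi_k] are the increments of the Wiener
    process over the time steps and [v_k] is [sqrt eps] times [A^k b]. The
    increments are independent and identically distributed, so reversing their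
    order does not change the law of the sum ([chain_law]); the reversed sums
    [\sum_(k < n) xi_k v_k] converge almost surely as soon as the powers of [A]
    decay geometrically ([partial_noise_ae_cvg]). Let [mu] be the law of the
    limit. The chain started from any law then converges in law to [mu]
    ([chain_cvg]), which leaves no other invariant law, and [mu] is invariant
    because [n] fresh noise terms added to [A^n] applied to an independent copy
    of a partial sum form a longer partial sum ([stationary_chain]). Laws on the
    plane are compared through bounded continuous functions
    ([probability_eq_on_continuous]).

    The linear projections of the partial sums are weighted sums of increments.
    They are normal because the Wiener process itself adds independent normal
    variables: rescaled increments have the law of increments over other
    intervals, and these telescope ([sum_incr_law]). In the limit the projection
    with coefficients [w = (u, v)] is normal with variance
    [h \sum_k (w . v_k)^2] ([normal_law_limit]).

    This series is the only solution [q] of the Lyapunov equation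
    [q(w) = q(A^T w) + eps h (w . b)^2] ([lyapunov_series]). The closed formula
    for the covariance also solves it: written with the eigenvectors
    [(A - l2) b] and [(A - l1) b], the quadratic form of the formula has one
    term for each pair of eigenvalues, and the transpose of [A] multiplies it by
    their product ([sigma_form_lyapunov]). Since the eigenvalues may be complex,
    the comparison is made on real and imaginary parts ([sigma_real]).

    Smallness of [h] enters twice. The matrix [(A - 1) / h] tends to the matrix
    of the damped oscillator, which strictly decreases a quadratic energy; hence
    so does one step of the scheme, and the powers of [A] decay
    ([scheme_contraction]). The denominators of the formula are, up to powers of
    [h], close to [nu ^+ 2 - 4], [nu], [1] and [4], hence nonzero
    ([scheme_nondegenerate]). *)

(** * Comparing laws *)

Section laws.
Set Implicit Arguments.
Unset Strict Implicit.
Context {R : realType}.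

(** Stated between functions on two probability spaces, not between image
    measures, so that neither side has to be packaged as a measure. *)
Definition same_law {d1 d2 d} {T1 : measurableType d1} {T2 : measurableType d2}
    {S : measurableType d} (P1 : probability T1 R) (X1 : T1 -> S)
    (P2 : probability T2 R) (X2 : T2 -> S) : Prop :=
  forall B, measurable B -> P1 (X1 @^-1` B) = P2 (X2 @^-1` B).

(** Rectangles form a pi-system that generates the product sigma-algebra. *)
Lemma measure_eq_on_rectangles d1 d2 (S1 : measurableType d1)
    (S2 : measurableType d2) (m1 m2 : {measure set (S1 * S2)%type -> \bar R}) :
  (m1 setT < +oo)%E ->
  (forall B C, measurable B -> measurable C -> m1 (B `*` C) = m2 (B `*` C)) ->
  forall D, measurable D -> m1 D = m2 D.
Proof.
move=> m1oo m12 D mD.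
apply: (measure_unique [set B `*` C | B in measurable & C in measurable]
  (fun=> setT)) => //.
- by rewrite measurable_prod_measurableType.
- move=> _ _ [B mB [C mC <-]] [B' mB' [C' mC' <-]]; rewrite -setXI.
  by exists (B `&` B'); [exact: measurableI|
     exists (C `&` C') => //; exact: measurableI].
- by move=> _; exists setT => //; exists setT => //; rewrite setXTT.
- by rewrite bigcup_const.
- by move=> _ [B mB [C mC <-]]; exact: m12.
Qed.

(** For independent components this says that the joint law is determined by
    the marginals. *)
Lemma same_law_pair d1 d2 d d' (T1 : measurableType d1) (T2 : measurableType d2)
    (S : measurableType d) (S' : measurableType d')
    (P1 : probability T1 R) (U1 : T1 -> S) (V1 : T1 -> S')
    (P2 : probability T2 R) (U2 : T2 -> S) (V2 : T2 -> S') :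
  measurable_fun setT U1 -> measurable_fun setT V1 ->
  measurable_fun setT U2 -> measurable_fun setT V2 ->
  (forall B C, measurable B -> measurable C ->
     P1 (U1 @^-1` B `&` V1 @^-1` C) = P2 (U2 @^-1` B `&` V2 @^-1` C)) ->
  same_law P1 (fun w => (U1 w, V1 w)) P2 (fun w => (U2 w, V2 w)).
Proof.
move=> mU1 mV1 mU2 mV2 E D mD.
have mX1 := measurable_fun_pair mU1 mV1.
have mX2 := measurable_fun_pair mU2 mV2.
pose X1 : {mfun T1 >-> (S * S')%type} := HB.pack (fun w => (U1 w, V1 w))
  (isMeasurableFun.Build _ _ _ _ _ mX1).
pose X2 : {mfun T2 >-> (S * S')%type} := HB.pack (fun w => (U2 w, V2 w))
  (isMeasurableFun.Build _ _ _ _ _ mX2).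
apply: (@measure_eq_on_rectangles _ _ _ _ (distribution P1 X1)
  (distribution P2 X2)) => //.
by have /= -> := probability_setT (distribution P1 X1); rewrite ltry.
Qed.

Lemma same_law_comp d1 d2 d d' (T1 : measurableType d1) (T2 : measurableType d2)
    (S : measurableType d) (S' : measurableType d') (f : S -> S')
    (P1 : probability T1 R) (X1 : T1 -> S) (P2 : probability T2 R) X2 :
  measurable_fun setT f -> same_law P1 X1 P2 X2 ->
  same_law P1 (f \o X1) P2 (f \o X2).
Proof.
by move=> mf E B mB; apply: (E (f @^-1` B)); rewrite -[X in measurable X]setTI; apply: mf.
Qed.

Lemma integrable_bounded d (T : measurableType d) (P : probability T R)
    (f : T -> R) (M : R) :
  measurable_fun setT f -> (forall x, `|f x| <= M) ->
  P.-integrable setT (EFin \o f).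
Proof.
move=> mf fM; apply: (@le_integrable _ _ _ _ setT measurableT _ (EFin \o cst M)).
- exact/measurable_EFinP.
- by move=> x _ /=; rewrite lee_fin (le_trans (fM x))// ler_norm.
- exact: finite_measure_integrable_cst.
Qed.

Lemma same_law_integral d1 d2 d (T1 : measurableType d1) (T2 : measurableType d2)
    (S : measurableType d) (P1 : probability T1 R) (X1 : T1 -> S)
    (P2 : probability T2 R) (X2 : T2 -> S) (f : S -> R) (M : R) :
  measurable_fun setT X1 -> measurable_fun setT X2 -> same_law P1 X1 P2 X2 ->
  measurable_fun setT f -> (forall x, `|f x| <= M) ->
  (\int[P1]_w (f (X1 w))%:E = \int[P2]_w (f (X2 w))%:E)%E.
Proof.
move=> mX1 mX2 X12 mf fM.
have i1 : P1.-integrable setT (EFin \o (f \o X1)).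
  by apply: (@integrable_bounded _ _ _ _ M) => [|x]; [exact: measurableT_comp|exact: fM].
have i2 : P2.-integrable setT (EFin \o (f \o X2)).
  by apply: (@integrable_bounded _ _ _ _ M) => [|x]; [exact: measurableT_comp|exact: fM].
have mEf : measurable_fun setT (EFin \o f) by exact/measurable_EFinP.
rewrite -(@integral_pushforward _ _ _ _ R X1 mX1 P1 setT (EFin \o f))//.
rewrite -(@integral_pushforward _ _ _ _ R X2 mX2 P2 setT (EFin \o f))//.
apply: eq_measure_integral => /= B mB _.
exact: X12.
Qed.

End laws.

(** * Bounded continuous functions determine a law on the plane *)

Section determination.
Set Implicit Arguments.
Unset Strict Implicit.
Context {R : realType}.

(** An open set is the union of the countably many boxes with rational centre
    and radius [1 / k] that it contains; boxes are rectangles, hence measurable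
    for the product sigma-algebra. *)
Lemma open_measurable_plane (O : set (R * R)) : open O -> measurable O.
Proof.
move=> oO.
pose box (t : rat * rat * nat) : set (R * R) :=
  ball (ratr t.1.1 : R) (t.2.+1%:R^-1) `*` ball (ratr t.1.2 : R) (t.2.+1%:R^-1).
pose F t := if `[< box t `<=` O >] then box t else set0.
suff -> : O = \bigcup_t F t.
  apply: countable_bigcupT_measurable => // t; rewrite /F; case: ifP => // _.
  by apply: measurableX; exact: measurable_ball.
apply/seteqP; split; last first.
  by move=> x [t _]; rewrite /F; case: asboolP => // + xt; apply.
move=> p Op.
have /nbhs_ballP[e /= e0 peO] : nbhs p O by exact: open_nbhs_nbhs.
(* a box of radius less than [e / 2] that contains [p] has diameter below [e] *)
have [k ke] : exists k : nat, k.+1%:R^-1 < e / 2.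
  have /ltr_add_invr[k] : 0 < e / 2 by rewrite divr_gt0.
  by rewrite add0r; exists k.
have k0 : 0 < k.+1%:R^-1 :> R by rewrite invr_gt0.
have near_rat (x : R) : exists q : rat, `|ratr q - x| < k.+1%:R^-1.
  have [|q] := @rat_in_itvoo R (x - k.+1%:R^-1) (x + k.+1%:R^-1).
    by rewrite ltrD2l gtrN.
  by rewrite in_itv/= -ltr_distl => ?; exists q.
have [q1 h1] := near_rat p.1; have [q2 h2] := near_rat p.2.
have boxO : box (q1, q2, k) `<=` O.
  move=> y [/= y1 y2]; apply: peO.
  have tri (u v w : R) : `|u - w| < k.+1%:R^-1 -> `|u - v| < k.+1%:R^-1 -> `|w - v| < e.
    move=> uw uv; apply: (le_lt_trans (ler_distD u _ _)).
    by rewrite (distrC w) (splitr e) ltrD// (lt_trans _ ke).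
  by split; [exact: (tri (ratr q1))|exact: (tri (ratr q2))].
exists (q1, q2, k) => //; by rewrite /F; case: asboolP => // /(_ boxO).
Qed.

Lemma continuous_measurable_plane (f : R * R -> R) :
  continuous f -> measurable_fun setT f.
Proof.
move=> cf; apply: (measurability _ (RGenOInfty.measurableE R)) => _ [_ [a ->]] <-.
rewrite setTI; apply: open_measurable_plane.
by move/continuousP: cf; apply; exact: interval_open.
Qed.

(** A continuous ramp from 0 at [a] to 1 at [a + 1 / n]; it increases to the
    indicator of the open ray beyond [a]. *)
Let ray (a : R) (n : nat) (x : R) : R := Num.min 1 (Num.max 0 (n%:R * (x - a))).

Let ray_continuous a n : continuous (ray a n).
Proof.
move=> x; apply: (@continuous_min R R (cst 1) (fun y => Num.max 0 (n%:R * (y - a))) x).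
  exact: cst_continuous.
apply: (@continuous_max R R (cst 0) (fun y => n%:R * (y - a)) x).
  exact: cst_continuous.
apply: continuousM; first exact: cst_continuous.
by apply: continuousB; [exact: cvg_id|exact: cst_continuous].
Qed.

Let ray_bounds a n x : 0 <= ray a n x <= 1.
Proof. by rewrite /ray le_min ler01 le_max lexx ge_min lexx. Qed.

Let ray_cvg a x : ray a ^~ x @ \oo --> (\1_`]a, +oo[%classic x : R).
Proof.
rewrite indicE; have [xa|ax] := leP x a.
  rewrite memNset/= ?in_itv/= ?andbT; last by apply/negP; rewrite -leNgt.
  rewrite (_ : ray a ^~ x = cst 0); first exact: cvg_cst.
  apply/funext => n; rewrite /ray /= max_l ?min_r//.
  by rewrite mulr_ge0_le0// subr_le0.
rewrite mem_set/= ?in_itv/= ?andbT//.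
apply: (@cvg_near_cst _ _ _ _ _ _ _); near=> n.
have xa0 : 0 < x - a by rewrite subr_gt0.
rewrite /ray min_l// le_max; apply/orP; right.
rewrite -ler_pdivrMr// mul1r; near: n; exact: nbhs_infty_ger.
Unshelve. all: by end_near. Qed.

Lemma measure_eq_on_rays (m1 m2 : {measure set R -> \bar R}) :
  (m1 setT < +oo)%E ->
  (forall a, m1 `]a, +oo[%classic = m2 `]a, +oo[%classic) ->
  forall B, measurable B -> m1 B = m2 B.
Proof.
move=> m1oo E B mB.
pose ray_set (a : R) : set R := `]a, +oo[%classic.
have mray a : measurable (ray_set a) by exact: measurable_itv.
apply: (measure_unique (range ray_set) (fun k => ray_set (- k%:R))) => //.
- rewrite [LHS]RGenOInfty.measurableE; congr (<<s _ >>).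
  by apply/seteqP; split=> [_ [x ->]|_ [x _ <-]]; exists x.
- move=> _ _ [a _ <-] [b _ <-]; exists (Num.max a b) => //.
  rewrite /ray_set; apply/seteqP; split => x /=; rewrite !in_itv/= !andbT gt_max.
    by move=> /andP[].
  by move=> [-> ->].
- apply/seteqP; split => // x _; exists (Num.bound x) => //.
  by rewrite /ray_set /= in_itv/= andbT ltrNl unstable.ltrNbound.
- by move=> _ [a _ <-]; exact: E.
- by move=> k; apply: le_lt_trans m1oo; rewrite le_measure ?inE.
Qed.

(** Apply the one-dimensional statement twice, with the other factor of the
    rectangle frozen. *)
Lemma measure_eq_on_quadrants (m1 m2 : {measure set (R * R)%type -> \bar R}) :
  (m1 setT < +oo)%E ->
  (forall a b, m1 (`]a, +oo[ `*` `]b, +oo[)%classic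
             = m2 (`]a, +oo[ `*` `]b, +oo[)%classic) ->
  forall B, measurable B -> m1 B = m2 B.
Proof.
move=> m1oo E; apply: measure_eq_on_rectangles => // B C mB mC.
have fin (D : set (R * R)) : measurable D -> (m1 D < +oo)%E.
  by move=> mD; apply: le_lt_trans m1oo; rewrite le_measure ?inE.
have section2 (m : {measure set (R * R)%type -> \bar R}) (B' : set R) :
    measurable B' ->
    exists mu : {measure set R -> \bar R}, forall C', mu C' = m (B' `*` C').
  move=> mB'; have mD : measurable (B' `*` [set: R]) by exact: measurableX.
  unshelve eexists (pushforward (mrestr m mD) snd); first exact: measurable_snd.
  move=> C'; rewrite /= /pushforward /mrestr; congr (m _).
  by apply/seteqP; split => [[x y]|[x y]] /= => [[? []]|[]].
have section1 (m : {measure set (R * R)%type -> \bar R}) (C' : set R) :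
    measurable C' ->
    exists mu : {measure set R -> \bar R}, forall B', mu B' = m (B' `*` C').
  move=> mC'; have mD : measurable ([set: R] `*` C') by exact: measurableX.
  unshelve eexists (pushforward (mrestr m mD) fst); first exact: measurable_fst.
  move=> B'; rewrite /= /pushforward /mrestr; congr (m _).
  by apply/seteqP; split => [[x y]|[x y]] /= => [[? []]|[]].
have [mu1 mu1E] := section1 m1 C mC; have [mu2 mu2E] := section1 m2 C mC.
rewrite -mu1E -mu2E; apply: measure_eq_on_rays => // [|a].
  by rewrite mu1E fin//; exact: measurableX.
rewrite mu1E mu2E; have ma : measurable (`]a, +oo[%classic : set R) by exact: measurable_itv.
have [nu1 nu1E] := section2 m1 _ ma; have [nu2 nu2E] := section2 m2 _ ma.
rewrite -nu1E -nu2E; apply: measure_eq_on_rays => // [|b].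
  by rewrite nu1E fin//; exact: measurableX.
by rewrite nu1E nu2E E.
Qed.

(** The indicator of an open quadrant is a bounded limit of continuous
    functions, products of two ramps, and quadrants determine the measure. *)
Lemma probability_eq_on_continuous (m1 m2 : probability (R * R)%type R) :
  (forall (f : R * R -> R) (M : R), continuous f -> (forall x, `|f x| <= M) ->
     (\int[m1]_x (f x)%:E = \int[m2]_x (f x)%:E)%E) ->
  forall B, measurable B -> m1 B = m2 B.
Proof.
move=> E; apply: measure_eq_on_quadrants => [|a b].
  by have /= -> := probability_setT m1; rewrite ltry.
pose f n (x : R * R) := ray a n x.1 * ray b n x.2.
have cf n : continuous (f n).
  move=> x; apply: cvgM.
    by apply: (@continuous_comp _ _ _ fst (ray a n)); [exact: cvg_fst|exact: ray_continuous].
  by apply: (@continuous_comp _ _ _ snd (ray b n)); [exact: cvg_snd|exact: ray_continuous].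
have fM n x : `|f n x| <= 1.
  have /andP[? ?] := ray_bounds a n x.1; have /andP[? ?] := ray_bounds b n x.2.
  by rewrite ger0_norm ?mulr_ge0// mulr_ile1.
set D := (_ `*` _)%classic.
have mD : measurable D by apply: measurableX; exact: measurable_itv.
have f_cvg x : f ^~ x @ \oo --> (\1_D x : R).
  rewrite (_ : \1_D x = \1_`]a, +oo[%classic x.1 * \1_`]b, +oo[%classic x.2).
    by apply: cvgM; exact: ray_cvg.
  by rewrite !indicE in_setX -natrM mulnb.
have lim (m : probability (R * R)%type R) :
    (\int[m]_x (f n x)%:E)%E @[n --> \oo] --> m D.
  have [| | | | |_ _] := @dominated_convergence _ _ _ m setT measurableT
    (fun n => EFin \o f n) (EFin \o \1_D) (EFin \o cst 1).
  - by move=> n; apply/measurable_EFinP; exact: continuous_measurable_plane.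
  - by apply/measurable_EFinP; exact: measurable_indic.
  - by apply: aeW => x _ /=; apply: cvg_EFin; [exact: nearW|exact: f_cvg].
  - exact: finite_measure_integrable_cst.
  - by apply: aeW => x n _ /=; rewrite lee_fin.
  by rewrite integral_indic// setIT.
have := lim m1; under eq_fun do rewrite (E _ 1 (cf _) (fM _)).
by move/cvg_unique; apply => //; exact: lim.
Qed.

End determination.

(** * Recursions driven by independent noise *)

Section independence.
Context {R : realType}.
Set Implicit Arguments.
Unset Strict Implicit.

Fixpoint drive (S : Type) (g : nat -> S -> R -> S) (u : S) (z : nat -> R)
    (n : nat) : S :=
  if n is m.+1 then g m (drive g u z m) (z m) else u.

(** The recursion adds noise at the end, but independence is propagated by
    absorbing the first noise term into the starting point. *)
Lemma drive_recl (S : Type) (g : nat -> S -> R -> S) u z n :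
  drive g u z n.+1 = drive (g \o succn) (g 0 u (z 0)) (z \o succn) n.
Proof. by elim: n => //= n ->. Qed.

(** The starting point [U] and the first [n] noise terms are mutually
    independent: some of the sets may be the whole space, so every subfamily
    is covered. *)
Definition independent_prefix d d' (T : measurableType d)
    (S : measurableType d') (P : probability T R)
    (U : T -> S) (xi : nat -> T -> R) (n : nat) : Prop :=
  forall (B : set S) (C : nat -> set R),
    measurable B -> (forall k, measurable (C k)) ->
    P (U @^-1` B `&` \big[setI/setT]_(k < n) (xi k @^-1` C k))
    = (P (U @^-1` B) * \prod_(k < n) P (xi k @^-1` C k))%E.

Definition independent_seq d (T : measurableType d) (P : probability T R)
    (xi : nat -> T -> R) (n : nat) : Prop :=
  forall C : nat -> set R, (forall k, measurable (C k)) ->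
    P (\big[setI/setT]_(k < n) (xi k @^-1` C k))
    = (\prod_(k < n) P (xi k @^-1` C k))%E.

Lemma independent_prefix_cst d d' (T : measurableType d)
    (S : measurableType d') (P : probability T R) (u : S)
    (xi : nat -> T -> R) n :
  independent_seq P xi n -> independent_prefix P (cst u) xi n.
Proof.
move=> ind B C mB mC; have [Bu|Bu] := boolP (u \in B).
  rewrite (_ : cst u @^-1` B = setT); last first.
    by apply/seteqP; split => // x _; exact: set_mem.
  by rewrite setTI probability_setT mul1e ind.
rewrite (_ : cst u @^-1` B = set0).
  by rewrite set0I measure0 mul0e.
by apply/seteqP; split => // x /= /mem_set; rewrite (negbTE Bu).
Qed.

Lemma measurable_fun_preimage d d' (T : measurableType d)
    (S : measurableType d') (f : T -> S) B :
  measurable_fun setT f -> measurable B -> measurable (f @^-1` B).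
Proof. by move=> mf mB; rewrite -[X in measurable X]setTI; exact: mf. Qed.

Lemma independent_prefix_pair d d' (T : measurableType d)
    (S : measurableType d') (P : probability T R)
    (U : T -> S) (xi : nat -> T -> R) n (B : set S) (C : set R) :
  independent_prefix P U xi n.+1 -> measurable B -> measurable C ->
  P (U @^-1` B `&` xi 0%N @^-1` C) = (P (U @^-1` B) * P (xi 0%N @^-1` C))%E.
Proof.
move=> ind mB mC.
have := ind B (fun k => if k is 0%N then C else setT) mB.
rewrite !big_ord_recl /= !big1 ?mule1 ?setIT => [|k _|k _]; last 2 first.
- by rewrite preimage_setT probability_setT.
- by rewrite preimage_setT.
by apply; case.
Qed.

(** The product rule for [g (U, xi 0)] and the remaining noise is an equality
    of two finite measures, evaluated at the preimage of [B] by [g]; the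
    hypothesis gives it on rectangles. *)
Lemma independent_prefix_step d d' d'' (T : measurableType d)
    (S : measurableType d') (S' : measurableType d'') (P : probability T R)
    (U : T -> S) (xi : nat -> T -> R) (g : S -> R -> S') n :
  measurable_fun setT U -> (forall k, measurable_fun setT (xi k)) ->
  measurable_fun setT (fun p => g p.1 p.2) ->
  independent_prefix P U xi n.+1 ->
  independent_prefix P (fun w => g (U w) (xi 0%N w)) (xi \o succn) n.
Proof.
move=> mU mxi mg ind B C mB mC.
pose tail := \big[setI/setT]_(k < n) (xi k.+1 @^-1` C k).
have mtail : measurable tail.
  apply: big_ind => //; first exact: measurableI.
  by move=> k _; apply: measurable_fun_preimage.
have tailE : P tail = (\prod_(k < n) P (xi k.+1 @^-1` C k))%E.
  have := ind setT (fun k => if k is k'.+1 then C k' else setT) measurableT.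
  rewrite !big_ord_recl /= !preimage_setT !probability_setT !setTI !mul1e.
  by apply; case.
pose X w := (U w, xi 0%N w).
have mX : measurable_fun setT X by exact: measurable_fun_pair.
rewrite -tailE; set D := (fun p => g p.1 p.2) @^-1` B.
have mD : measurable D by exact: measurable_fun_preimage.
have [m1 m1E] : exists m : {measure set (S * R)%type -> \bar R},
    forall D, m D = P (X @^-1` D `&` tail).
  by unshelve eexists (pushforward (mrestr P mtail) X).
have PtailK : (fine (P tail))%:E = P tail by rewrite fineK// fin_num_measure.
have [m2 m2E] : exists m : {measure set (S * R)%type -> \bar R},
    forall D, m D = (P (X @^-1` D) * P tail)%E.
  have pt0 : 0 <= fine (P tail) by rewrite fine_ge0.
  unshelve eexists (mscale (NngNum pt0) (pushforward P X)) => //.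
  by move=> D1; rewrite -[X in (_ * X)%E]PtailK muleC.
have := @measure_eq_on_rectangles R _ _ S R m1 m2.
rewrite m1E => /(_ _ _ _ mD); rewrite m1E m2E; apply.
  rewrite (le_lt_trans (probability_le1 _ _)) ?ltry//.
  by rewrite preimage_setT setTI.
move=> B' C' mB' mC'; rewrite m1E m2E.
have -> : X @^-1` (B' `*` C') = U @^-1` B' `&` xi 0%N @^-1` C' by [].
rewrite (independent_prefix_pair ind)//.
have := ind B' (fun k => if k is k'.+1 then C k' else C') mB'.
rewrite !big_ord_recl /= -/tail -tailE muleA setIA; apply.
by case.
Qed.

(** The law of the state after [n] steps depends on the starting point and the
    noise only through their marginal laws. Reordering the noise, replacing it
    by another sequence, or moving to another probability space is therefore
    harmless as long as independence is kept. *)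
Lemma same_law_drive d1 d2 d (T1 : measurableType d1) (T2 : measurableType d2)
    (S : measurableType d) (P1 : probability T1 R) (P2 : probability T2 R)
    (U1 : T1 -> S) (U2 : T2 -> S) (xi1 : nat -> T1 -> R) (xi2 : nat -> T2 -> R)
    (g : nat -> S -> R -> S) n :
  measurable_fun setT U1 -> (forall k, measurable_fun setT (xi1 k)) ->
  measurable_fun setT U2 -> (forall k, measurable_fun setT (xi2 k)) ->
  (forall k, measurable_fun setT (fun p => g k p.1 p.2)) ->
  independent_prefix P1 U1 xi1 n -> independent_prefix P2 U2 xi2 n ->
  same_law P1 U1 P2 U2 ->
  (forall k, (k < n)%N -> same_law P1 (xi1 k) P2 (xi2 k)) ->
  same_law P1 (fun w => drive g (U1 w) (xi1 ^~ w) n)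
           P2 (fun w => drive g (U2 w) (xi2 ^~ w) n).
Proof.
elim: n => [|n IH] in U1 U2 xi1 xi2 g *; first by [].
move=> mU1 mxi1 mU2 mxi2 mg ind1 ind2 U12 xi12.
have mstep d' (T' : measurableType d') (U : T' -> S) (xi : nat -> T' -> R) :
    measurable_fun setT U -> (forall k, measurable_fun setT (xi k)) ->
    measurable_fun setT (fun w => g 0%N (U w) (xi 0%N w)).
  move=> mU mxi.
  exact: (measurableT_comp (mg 0%N) (measurable_fun_pair mU (mxi 0%N))).
have peel d' (T' : measurableType d') (U : T' -> S) (xi : nat -> T' -> R) :
    (fun w => drive g (U w) (xi ^~ w) n.+1) =
    (fun w => drive (fun k => g k.+1) (g 0%N (U w) (xi 0%N w))
       (fun k => xi k.+1 w) n).
  by apply/funext => w; rewrite drive_recl.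
rewrite !peel.
apply: (IH (fun w => g 0%N (U1 w) (xi1 0%N w)) (fun w => g 0%N (U2 w) (xi2 0%N w))
           (fun k => xi1 k.+1) (fun k => xi2 k.+1)) => //.
- exact: mstep.
- exact: mstep.
- by apply: (independent_prefix_step _ _ (mg 0%N)).
- by apply: (independent_prefix_step _ _ (mg 0%N)).
- have U_xi : same_law P1 (fun w => (U1 w, xi1 0%N w))
                       P2 (fun w => (U2 w, xi2 0%N w)).
    apply: same_law_pair => // B C mB mC.
    by rewrite (independent_prefix_pair ind1)// (independent_prefix_pair ind2)//
               U12// xi12.
  exact: (same_law_comp (mg 0%N) U_xi).
- by move=> k kn; exact: xi12.
Qed.

End independence.

(** * Scaling of normal laws *)

Section normal.
Context {R : realType}.
Set Implicit Arguments.
Unset Strict Implicit.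
Notation mu := (@lebesgue_measure R).
Notation gauss := (@normal_prob R 0 1).

Lemma lebesgue_measure_scale (s : R) (B : set R) : s != 0 -> measurable B ->
  pushforward mu ( *%R s) B = (`|s|^-1%:E * mu B)%E.
Proof.
move=> s0 mB; have s_gt0 : 0 < `|s| by rewrite normr_gt0.
have ms : measurable_fun setT ( *%R s : R -> R) by exact: mulrl_measurable.
have s_ge0 : 0 <= `|s| by [].
have [m mE] : exists m : {measure set (measurableTypeR R) -> \bar R}, forall C,
    m C = (`|s|%:E * mu ( *%R s @^-1` C))%E.
  by unshelve eexists (mscale (NngNum s_ge0) (pushforward mu
    ( *%R s : measurableTypeR R -> measurableTypeR R))).
suff mu_m : mu B = m B.
  by rewrite mu_m mE muleA -EFinM mulVf ?gt_eqF// mul1e.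
apply: (@lebesgue_measure_unique R m _ B mB) => _ [[a b] /= _ <-].
rewrite mE; have [sn|sp] : s < 0 \/ 0 < s by case: ltgtP s0 => //; [left|right].
  rewrite (_ : _ @^-1` _ = `[b / s, a / s[%classic); last first.
    apply/seteqP; split => x /=; rewrite !in_itv/= ler_ndivrMr// ltr_ndivlMr//.
      by rewrite mulrC andbC.
    by rewrite mulrC andbC.
  rewrite !lebesgue_measure_itv/= !lte_fin ltr_nM2r ?invr_lt0//.
  case: ifP => _; last by rewrite mule0.
  rewrite -!EFinB -EFinM ltr0_norm//; congr EFin.
  by field; rewrite lt_eqF.
rewrite (_ : _ @^-1` _ = `]a / s, b / s]%classic); last first.
  apply/seteqP; split => x /=; rewrite !in_itv/= ltr_pdivrMr// ler_pdivlMr//.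
    by rewrite mulrC.
  by rewrite mulrC.
rewrite !lebesgue_measure_itv/= !lte_fin ltr_pM2r ?invr_gt0//.
case: ifP => _; last by rewrite mule0.
rewrite -!EFinB -EFinM gtr0_norm//; congr EFin.
by field; rewrite gt_eqF.
Qed.

(** Every centred normal law, the degenerate one included, is the image of the
    standard one by a homothety. *)
Lemma normal_law_scale (s : R) (B : set R) : measurable B ->
  normal_law 0 s B = gauss ( *%R s @^-1` B).
Proof.
move=> mB; rewrite /normal_law; case: eqVneq => [->|s0].
  rewrite diracE; have [B0|B0] := boolP (0 \in B).
    rewrite (_ : _ @^-1` _ = setT) ?probability_setT//.
    by apply/seteqP; split => // x _ /=; rewrite mul0r; exact: set_mem.
  rewrite (_ : _ @^-1` _ = set0) ?measure0//.
  by apply/seteqP; split => // x /=; rewrite mul0r => /mem_set; rewrite (negbTE B0).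
have ms : measurable_fun setT ( *%R s : R -> R) by exact: mulrl_measurable.
rewrite /normal_prob.
have -> : (\int[mu]_(x in *%R s @^-1` B) (normal_pdf 0 1 x)%:E =
    \int[mu]_(x in *%R s @^-1` B) ((fun y => (normal_pdf 0 1 (s^-1 * y))%:E) \o *%R s) x)%E.
  by apply: eq_integral => x _ /=; rewrite mulKf.
rewrite -(@ge0_integral_pushforward _ _ (measurableTypeR R) (measurableTypeR R)
  R ( *%R s) ms mu B)//; last 2 first.
- apply/measurable_EFinP/measurable_funTS.
  by apply: measurableT_comp; [exact: measurable_normal_pdf|exact: mulrl_measurable].
- by move=> y _; rewrite lee_fin normal_pdf_ge0.
have s1 : 0 <= `|s|^-1 by rewrite invr_ge0.
transitivity (\int[mscale (NngNum s1) mu]_(y in B) (normal_pdf 0 1 (s^-1 * y))%:E)%E; last first.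
  have [pm pmE] : exists pm : {measure set (measurableTypeR R) -> \bar R},
      pm = @pushforward _ _ (measurableTypeR R) (measurableTypeR R) R mu ( *%R s)
        :> (set (measurableTypeR R) -> \bar R).
    by unshelve eexists (pushforward mu
      ( *%R s : measurableTypeR R -> measurableTypeR R)).
  rewrite -pmE; apply: eq_measure_integral => C mC _.
  by rewrite pmE; exact/esym/lebesgue_measure_scale.
rewrite ge0_integral_mscale//; last 2 first.
- apply/measurable_EFinP/measurable_funTS.
  by apply: measurableT_comp; [exact: measurable_normal_pdf|exact: mulrl_measurable].
- by move=> y _; rewrite lee_fin normal_pdf_ge0.
rewrite -ge0_integralZl//; last 2 first.
- apply/measurable_EFinP/measurable_funTS.
  by apply: measurableT_comp; [exact: measurable_normal_pdf|exact: mulrl_measurable].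
- by move=> y _; rewrite lee_fin normal_pdf_ge0.
apply: eq_integral => x _; rewrite -EFinM; congr EFin.
rewrite !normal_pdfE ?oner_neq0// /normal_peak /normal_fun !subr0 mulrA; congr (_ * expR _).
  rewrite expr1n mul1r -mulrnAr sqrtrM ?sqr_ge0// sqrtr_sqr.
  by rewrite invfM.
by field.
Qed.

Import HBNNSimple.

(** The defining density formula extends from indicators to simple functions
    and then by monotone convergence. *)
Lemma integral_normal_prob (m s : R) (f : measurableTypeR R -> \bar R) :
  measurable_fun setT f -> (forall x, 0 <= f x)%E ->
  (\int[normal_prob m s]_x f x = \int[mu]_x (f x * (normal_pdf m s x)%:E))%E.
Proof.
move=> mf f0; pose h := nnsfun_approx measurableT mf.
have mpdf : measurable_fun setT (EFin \o (normal_pdf m s)).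
  by apply/measurable_EFinP; exact: measurable_normal_pdf.
have pdf0 x : (0 <= (normal_pdf m s x)%:E)%E by rewrite lee_fin normal_pdf_ge0.
have mh n : measurable_fun setT (EFin \o h n) by exact/measurable_EFinP.
have -> : (\int[normal_prob m s]_x f x =
    lim (\int[normal_prob m s]_x (h n x)%:E @[n --> \oo]))%E.
  rewrite -monotone_convergence//=.
  - apply: eq_integral => x _; apply/esym/cvg_lim => //.
    exact: cvg_nnsfun_approx.
  - by move=> n x _; rewrite lee_fin; exact: fun_ge0.
  - by move=> x _ a b ab; rewrite lee_fin; exact/lefP/nd_nnsfun_approx.
have -> : (\int[mu]_x (f x * (normal_pdf m s x)%:E) =
    lim (\int[mu]_x ((h n x)%:E * (normal_pdf m s x)%:E) @[n --> \oo]))%E.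
  rewrite -monotone_convergence//=.
  - apply: eq_integral => x _; apply/esym/cvg_lim => //.
    by apply: cvgeZr => //; exact: cvg_nnsfun_approx.
  - by move=> n; exact: (emeasurable_funM (mh n) mpdf).
  - by move=> n x _; rewrite mule_ge0// lee_fin; exact: fun_ge0.
  - move=> x _ a b ab; rewrite lee_wpmul2r// lee_fin.
    exact/lefP/nd_nnsfun_approx.
congr (lim (_ @ \oo)); apply/funext => n.
under [LHS]eq_integral do rewrite fimfunE -fsumEFin//.
under [RHS]eq_integral.
  move=> x _; rewrite fimfunE -fsumEFin// ge0_mule_fsuml; last first.
    by move=> r; exact: nnfun_muleindic_ge0.
  over.
have mind r : measurable (h n @^-1` [set r]) by exact: measurable_sfunP.
have mrind r : measurable_fun setT (fun x => (r * \1_(h n @^-1` [set r]) x)%:E).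
  by apply/measurable_EFinP; apply: measurable_funM => //; exact: measurable_indic.
rewrite !ge0_integral_fsum//=; last 3 first.
- by move=> r; exact: (emeasurable_funM (mrind r) mpdf).
- by move=> r x _; rewrite mule_ge0// nnfun_muleindic_ge0.
- by move=> r x _; exact: nnfun_muleindic_ge0.
apply: eq_fsbigr => r /set_mem [x _ xr].
have r0 : 0 <= r by rewrite -xr.
under [LHS]eq_integral do rewrite EFinM.
under [RHS]eq_integral do rewrite EFinM -muleA.
have m1r : measurable_fun setT (fun x => (\1_(h n @^-1` [set r]) x : R)%:E).
  by apply/measurable_EFinP; exact: measurable_indic.
rewrite !ge0_integralZl//=; last 2 first.
- exact: (emeasurable_funM m1r mpdf).
- by move=> y _; rewrite mule_ge0// lee_fin.
congr (_ * _)%E; rewrite integral_indic//= setIT /normal_prob integral_mkcond.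
apply: eq_integral => y _; rewrite patchE indicE.
by case: ifP => _; rewrite ?mul1e ?mul0e.
Qed.

End normal.

(** * Second moment of the standard normal law *)

Section normal_moments.
Context {R : realType}.
Set Implicit Arguments.
Unset Strict Implicit.
Notation mu := (@lebesgue_measure R).
Notation gauss := (@normal_prob R 0 1).
Notation pdf := (@normal_pdf R 0 1).

Let pdfE x : pdf x = normal_peak 1 * expR (- x ^+ 2 / 2).
Proof. by rewrite normal_pdfE ?oner_neq0// /normal_fun subr0 expr1n. Qed.

Let is_derive_pdf (x : R) : is_derive x 1 pdf (- x * pdf x).
Proof.
have d1 : is_derive x (1 : R) (fun y : R => - y ^+ 2 / 2) (- x).
  rewrite (_ : (fun y => _) = (- 2^-1) *: (@id R ^+ 2)); last first.
    by apply/funext => y; rewrite !fctE /GRing.scale/=; field.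
  by apply: is_derive_eq; rewrite /GRing.scale/=; field.
rewrite (_ : normal_pdf 0 1 = normal_peak 1 *: (expR \o (fun y : R => - y ^+ 2 / 2))); last first.
  by apply/funext => y; rewrite pdfE.
apply: is_derive_eq; rewrite !fctE /GRing.scale /=.
by ring.
Qed.

Let pdf_continuous : continuous pdf.
Proof. exact: continuous_normal_pdf (oner_neq0 _). Qed.

(** Integration by parts with [pdf' = - x pdf]. *)
Let parts (n : nat) : (0 < n)%N ->
  (\int[mu]_(x in `[(- n%:R)%R, n%:R%R]) (x ^+ 2 * pdf x)%:E =
   (- 2 * n%:R * pdf n%:R)%R%:E + \int[mu]_(x in `[(- n%:R)%R, n%:R%R]) (pdf x)%:E)%E.
Proof.
move=> n0; have nn : - n%:R < n%:R :> R by rewrite gtrN// ltr0n.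
have cid : continuous (@id R) by move=> x; exact: cvg_id.
have := @integration_by_parts R id (- pdf) (cst 1) (fun x => x * pdf x) _ _ nn.
rewrite !fctE => ibp.
transitivity (\int[mu]_(x in `[(- n%:R)%R, n%:R%R]) (x * (x * pdf x))%:E)%E.
  by apply: eq_integral => x _; rewrite mulrA.
rewrite ibp.
- have pdfN : pdf (- n%:R) = pdf n%:R by rewrite !pdfE sqrrN.
  rewrite pdfN; congr (_%:E + _)%E; first by ring.
  rewrite -[RHS]oppeK; congr (oppe _).
  rewrite -integral_ge0N; last by move=> x _; rewrite lee_fin normal_pdf_ge0.
  by apply: eq_integral => x _; rewrite mul1r.
- by apply: continuous_subspaceT => x; exact: cst_continuous.
- split.
  + by move=> x _; exact: derivable_id.
  + by apply: cvg_at_right_filter; exact: cid.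
  + by apply: cvg_at_left_filter; exact: cid.
- by move=> x _; rewrite derive1E derive_id.
- by apply: continuous_subspaceT => x; apply: cvgM; [exact: cid|exact: pdf_continuous].
- split.
  + by move=> x _; apply: derivableN; have [] := is_derive_pdf x.
  + by apply: cvg_at_right_filter; apply: cvgN; exact: pdf_continuous.
  + by apply: cvg_at_left_filter; apply: cvgN; exact: pdf_continuous.
- move=> x _; rewrite derive1E deriveN; last by have [] := is_derive_pdf x.
  by have [_ ->] := is_derive_pdf x; rewrite mulNr opprK.
Qed.

Let itv_cvg (f : R -> R) : continuous f -> (forall x, 0 <= f x) ->
  (\int[mu]_(x in `[(- n%:R)%R, n%:R%R]) (f x)%:E)%E @[n --> \oo] -->
  (\int[mu]_x (f x)%:E)%E.
Proof.
move=> cf f0.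
have mf : measurable_fun setT (EFin \o f).
  by apply/measurable_EFinP; exact: continuous_measurable_fun.
rewrite (_ : setT = \bigcup_n `[- n%:R, n%:R]%classic); last first.
  apply/seteqP; split => // x _; exists (Num.bound x) => //=.
  rewrite in_itv/= lerNl; apply/andP; split.
    by rewrite ltW// unstable.ltrNbound.
  by rewrite ltW// unstable.ltr_bound.
apply: ge0_nondecreasing_set_cvg_integral.
- move=> m n mn; apply/subsetPset => x /=; rewrite !in_itv/= => /andP[h1 h2].
  have mn' : m%:R <= n%:R :> R by rewrite ler_nat.
  by rewrite (le_trans h2)// (le_trans _ h1)// lerN2.
- by move=> n; exact: measurable_itv.
- by move=> n; exact: measurable_funTS.
- by move=> n x _; rewrite lee_fin.
Qed.

(** The boundary term vanishes because [expR y] dominates [1 + y]; comparing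
    with [1 / (n + 1)] instead of [1 / n] avoids the case [n = 0]. *)
Let tail_cvg : (- 2 * n%:R * pdf n%:R)%R%:E @[n --> \oo] --> (0 : \bar R)%E.
Proof.
apply: cvg_EFin; first exact: nearW.
rewrite /=; have p0 : 0 < @normal_peak R 1 by rewrite normal_peak_gt0 ?oner_neq0.
have lim0 : (- (normal_peak 1 * 8) * n.+1%:R^-1 : R) @[n --> \oo] --> (0 : R).
  by rewrite -[X in _ --> X](mulr0 (- (normal_peak 1 * 8))); apply: cvgMr; exact: cvg_harmonic.
apply: (squeeze_cvgr _ lim0 (cvg_cst 0)); apply: nearW => n /=.
rewrite pdfE (mulNr (_ ^+ 2)) expRN; set y : R := n%:R ^+ 2 / 2.
have y0 : 0 <= y by rewrite divr_ge0 ?sqr_ge0.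
have ey : 1 + y <= expR y := expR_ge1Dx y.
have e0 : 0 < expR y := expR_gt0 y.
have n0 : 0 <= n%:R :> R by [].
rewrite !mulNr lerN2 oppr_le0; apply/andP; split; last first.
  by rewrite !mulr_ge0// ltW// invr_gt0.
rewrite ler_pdivlMr ?ltr0n//.
rewrite (_ : _ * n.+1%:R = normal_peak 1 * (2 * n%:R * n.+1%:R) / expR y); last first.
  by ring.
rewrite ler_pdivrMr// -(mulrA _ 8) ler_pM2l//.
apply: (@le_trans _ _ (8 * (1 + y))); last by rewrite ler_pM2l.
rewrite /y -natr1 -subr_ge0.
rewrite (_ : _ - _ = (n%:R - 1) ^+ 2 + n%:R ^+ 2 + 7); last by field.
by rewrite !addr_ge0 ?sqr_ge0.
Qed.

Lemma second_moment_gauss : (\int[gauss]_x (x ^+ 2)%:E = 1)%E.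
Proof.
rewrite integral_normal_prob; last 2 first.
- by apply/measurable_EFinP; exact: exprn_measurable.
- by move=> x; rewrite lee_fin sqr_ge0.
under eq_integral do rewrite -EFinM.
have lim1 : (\int[mu]_(x in `[(- n%:R)%R, n%:R%R]) (x ^+ 2 * pdf x)%:E)%E @[n --> \oo]
    --> (\int[mu]_x (x ^+ 2 * pdf x)%:E)%E.
  apply: itv_cvg => x.
    by apply: cvgM; [exact: exprn_continuous|exact: pdf_continuous].
  by rewrite mulr_ge0 ?sqr_ge0 ?normal_pdf_ge0.
have lim2 : ((- 2 * n%:R * pdf n%:R)%R%:E +
      \int[mu]_(x in `[(- n%:R)%R, n%:R%R]) (pdf x)%:E)%E @[n --> \oo]
    --> (0 + \int[mu]_x (pdf x)%:E)%E.
  apply: cvgeD => //.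
  by apply: itv_cvg => x; [exact: pdf_continuous|exact: normal_pdf_ge0].
rewrite integral_normal_pdf add0e in lim2.
apply: (cvg_unique _ lim1) => //.
apply: cvg_trans lim2; apply: near_eq_cvg; near=> n.
by rewrite parts//; near: n; exact: nbhs_infty_gt.
Unshelve. all: by end_near. Qed.

End normal_moments.

(** * Weighted sums of Wiener increments *)

Section wiener.
Context {R : realType}.
Set Implicit Arguments.
Unset Strict Implicit.
Notation gauss := (@normal_prob R 0 1).

Let to_line : measurableTypeR R -> R := id.

Let measurable_to_line : measurable_fun setT to_line.
Proof. by move=> _ B mB; rewrite setTI preimage_id. Qed.

HB.instance Definition _ :=
  isMeasurableFun.Build _ _ _ _ to_line measurable_to_line.

(** The standard normal law carried by [R] itself: [normal_prob] lives on a
    copy of the line whose measurable structure has another display. *)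
Definition std_normal : probability R R := distribution gauss to_line.

Lemma std_normalE (s : R) B : measurable B ->
  std_normal ( *%R s @^-1` B) = normal_law 0 s B.
Proof. by move=> mB; rewrite normal_law_scale. Qed.

Lemma second_moment_std_normal : (\int[std_normal]_x (x ^+ 2)%:E = 1)%E.
Proof.
rewrite ge0_integral_distribution//.
- exact: second_moment_gauss.
- by apply/measurable_EFinP; exact: exprn_measurable.
- by move=> x; rewrite lee_fin sqr_ge0.
Qed.

Lemma integrable_sqr_std_normal : std_normal.-integrable setT (fun x => (x ^+ 2)%:E).
Proof.
apply/integrableP; split.
  by apply/measurable_EFinP; exact: exprn_measurable.
under eq_integral do rewrite gee0_abs ?lee_fin ?sqr_ge0//.
by rewrite second_moment_std_normal ltry.
Qed.

Lemma integrable_std_normal : std_normal.-integrable setT (fun x => x%:E).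
Proof.
have int1 : std_normal.-integrable setT (fun x => 1%:E + (x ^+ 2)%:E)%E.
  apply: integrableD => //; first exact: finite_measure_integrable_cst.
  exact: integrable_sqr_std_normal.
apply: le_integrable int1 => //; first exact/measurable_EFinP.
move=> x _ /=; rewrite lee_fin (ger0_norm (addr_ge0 ler01 (sqr_ge0 x))).
rewrite -(real_normK (num_real x)); move: (`|x|) => y.
by rewrite -subr_ge0 (_ : _ - _ = (y - 2^-1) ^+ 2 + 3 / 4); [rewrite addr_ge0 ?sqr_ge0|field].
Qed.

Lemma normal_lawN (s : R) : normal_law 0 (- s) = normal_law 0 s :> (set R -> \bar R).
Proof.
rewrite /normal_law oppr_eq0; case: eqVneq => [_|s0]; first by [].
apply/funext => B; rewrite /normal_prob; apply: eq_integral => x _.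
by rewrite !normal_pdfE ?oppr_eq0// /normal_peak /normal_fun sqrrN.
Qed.

Lemma std_normal_normal_law B : measurable B -> std_normal B = normal_law 0 1 B.
Proof. by move=> _; rewrite /normal_law oner_eq0. Qed.

(** The law is symmetric, so the mean equals its opposite. *)
Lemma mean_std_normal : (\int[std_normal]_x x%:E = 0)%E.
Proof.
have mN : measurable_fun setT ( *%R (-1) : R -> R) by exact: mulrl_measurable.
have fin : (\int[std_normal]_x x%:E)%E \is a fin_num.
  exact: (integrable_fin_num measurableT integrable_std_normal).
have intN : std_normal.-integrable setT (fun x => (-1 * x)%:E).
  under eq_fun do rewrite EFinM.
  by apply: integrableZl => //; exact: integrable_std_normal.
suff : (\int[std_normal]_x x%:E = - \int[std_normal]_x x%:E)%E.
  rewrite -(fineK fin) -EFinN => -[] /eqP.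
  by rewrite -subr_eq0 opprK -mulr2n mulrn_eq0 /= => /eqP ->.
rewrite -mulN1e -(integralZl measurableT integrable_std_normal).
transitivity (\int[pushforward std_normal ( *%R (-1))]_x x%:E)%E; last first.
  rewrite integral_pushforward//.
apply: eq_measure_integral => B mB _.
by have := std_normalE (-1) mB; rewrite normal_lawN -std_normal_normal_law.
Qed.

Section increments.
Context d (T : measurableType d) (P : probability T R) (W : R -> {RV P >-> R}).
Hypothesis hW : standard_wiener W.

Definition incr (t : nat -> R) (k : nat) (w : T) : R := W (t k.+1) w - W (t k) w.

Lemma measurable_incr t k : measurable_fun setT (incr t k).
Proof. by apply: measurable_funB; exact: measurable_funP. Qed.

Lemma incr_law (t : nat -> R) k : 0 <= t k -> t k <= t k.+1 ->
  same_law P (incr t k) std_normal ( *%R (Num.sqrt (t k.+1 - t k))).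
Proof.
move=> t0 tt B mB; rewrite std_normalE//; move: tt; rewrite le_eqVlt => /predU1P[E|tt].
  rewrite /incr E subrr sqrtr0 /normal_law eqxx diracE.
  have [B0|B0] := boolP (0 \in B).
    rewrite (_ : _ @^-1` _ = setT) ?probability_setT//.
    by apply/seteqP; split => // x _ /=; rewrite subrr; exact: set_mem.
  rewrite (_ : _ @^-1` _ = set0) ?measure0//.
  by apply/seteqP; split => // x /=; rewrite subrr => /mem_set; rewrite (negbTE B0).
have [_ law _ _] := hW; have := law _ _ t0 tt _ mB.
by rewrite /pushforward /normal_law sqrtr_eq0 leNgt subr_gt0 tt.
Qed.

Lemma incr_independent (t : nat -> R) n :
  0 <= t 0%N -> (forall k, t k <= t k.+1) -> independent_seq P (incr t) n.
Proof.
move=> t0 tt C mC; have [_ _ ind _] := hW.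
have := ind n t t0 tt (fun i => C i) (fun i => mC i).
rewrite [X in P X](_ : _ = \big[setI/setT]_(k < n) (incr t k @^-1` C k)); first exact.
rewrite -(bigcap_mkord n (fun k => incr t k @^-1` C k)).
apply/seteqP; split => [w Hw k /= kn|w Hw i _]; first exact: (Hw (Ordinal kn)).
exact: (Hw i (ltn_ord i)).
Qed.

(** The Wiener process provides the stability of normal laws under independent
    sums: [c k * incr t k] has the law of the increment of [W] over an interval
    of length [h * c k ^+ 2], and consecutive increments telescope to a single
    one, which is normal by definition. *)
Lemma sum_incr_law (h : R) (c : nat -> R) n : 0 <= h ->
  same_law P (fun w => \sum_(k < n) c k * incr (fun k => k%:R * h) k w)
    std_normal ( *%R (Num.sqrt (h * \sum_(k < n) c k ^+ 2))).
Proof.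
move=> h0; pose t k := k%:R * h; pose s k := h * \sum_(j < k) c j ^+ 2.
have s0 k : 0 <= s k by rewrite mulr_ge0 ?sumr_ge0// => j _; rewrite sqr_ge0.
have sS k : s k.+1 - s k = h * c k ^+ 2.
  by rewrite /s big_ord_recr /= mulrDr addrAC subrr add0r.
have ss k : s k <= s k.+1 by rewrite -subr_ge0 sS mulr_ge0 ?sqr_ge0.
have t0 k : 0 <= t k by rewrite mulr_ge0.
have tt k : t k <= t k.+1 by rewrite ler_wpM2r// ler_nat.
have tS k : t k.+1 - t k = h by rewrite /t -natr1 mulrDl mul1r addrAC subrr add0r.
pose g (k : nat) (u z : R) := u + z.
have driveE (z : nat -> R) m : drive g 0 z m = \sum_(k < m) z k.
  by elim: m => [|m /= ->]; rewrite ?big_ord0 // big_ord_recr.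
(* a two-point time sequence, so that the telescoped sum is itself an [incr] *)
have telescope w : \sum_(k < n) incr s k w = incr (fun k => if k is 0%N then 0 else s n) 0%N w.
  rewrite -(big_mkord xpredT (fun k => incr s k w)) telescope_sumr//.
  by rewrite /incr /s big_ord0 mulr0.
have mc k : measurable_fun setT (fun w => c k * incr t k w).
  by apply: measurable_funM => //; exact: measurable_incr.
have same : same_law P (fun w => drive g 0 (fun k => c k * incr t k w) n)
                     P (fun w => drive g 0 (fun k => incr s k w) n).
  apply: (@same_law_drive R _ _ _ T T R P P (cst 0) (cst 0)
    (fun k w => c k * incr t k w) (incr s) g n) => //.
  - exact: measurable_incr.
  - by move=> k; apply: measurable_funD.
  - apply: independent_prefix_cst => C mC.
    have mC' k : measurable ( *%R (c k) @^-1` C k).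
      by apply: measurable_fun_preimage => //; exact: mulrl_measurable.
    exact: (@incr_independent t n (t0 0%N) tt
      (fun k => *%R (c k) @^-1` C k) mC').
  - by apply: independent_prefix_cst; exact: incr_independent.
  - move=> k _ B mB; rewrite (incr_law (s0 k) (ss k))// sS.
    have mB' : measurable ( *%R (c k) @^-1` B).
      by apply: measurable_fun_preimage => //; exact: mulrl_measurable.
    have := incr_law (t0 k) (tt k) mB'; rewrite tS => E.
    rewrite (_ : _ @^-1` B = incr t k @^-1` ( *%R (c k) @^-1` B))// E.
    rewrite -comp_preimage.
    rewrite (_ : _ \o _ = *%R (c k * Num.sqrt h)); last first.
      by apply/funext => x /=; rewrite mulrA.
    have -> : Num.sqrt (h * c k ^+ 2) = Num.sqrt h * `|c k|.
      by rewrite sqrtrM ?sqrtr_sqr.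
    rewrite (std_normalE _ mB) (std_normalE _ mB) mulrC.
    have [ck|ck] := leP 0 (c k); first by rewrite (ger0_norm ck).
    by rewrite (ltr0_norm ck) mulrN normal_lawN.
move=> B mB; rewrite (_ : _ @^-1` B = (fun w => drive g 0 (fun k => c k * incr t k w) n) @^-1` B); last first.
  by apply/seteqP; split => w /=; rewrite driveE.
rewrite same//.
pose r (k : nat) := if k is 0%N then 0 else s n.
rewrite (_ : _ @^-1` B = incr r 0%N @^-1` B); last first.
  by apply/seteqP; split => w /=; rewrite driveE telescope.
by rewrite (@incr_law r 0%N)//= subr0.
Qed.

End increments.
End wiener.

(** * Almost sure convergence of random series *)

Section random_series.
Context {R : realType} d (T : measurableType d) (P : probability T R).
Set Implicit Arguments.
Unset Strict Implicit.

Lemma geometric_sum_le (r : R) n : 0 <= r -> r < 1 ->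
  \sum_(0 <= k < n) r ^+ k <= (1 - r)^-1.
Proof.
move=> r0 r1; rewrite -[leRHS]mul1r ler_pdivlMr ?subr_gt0//.
suff -> : (\sum_(0 <= k < n) r ^+ k) * (1 - r) = 1 - r ^+ n.
  by rewrite gerBl exprn_ge0.
elim: n => [|n IH]; first by rewrite big_nil mul0r expr0 subrr.
by rewrite big_nat_recr//= mulrDl IH exprS; ring.
Qed.

(** The extended-real sum has a finite integral, hence is finite almost
    everywhere; its finite part is defined and measurable on the whole space. *)
Lemma ae_cvg_nonneg_series (f : nat -> T -> R) (C r : R) :
  (forall k, measurable_fun setT (f k)) -> (forall k w, 0 <= f k w) ->
  0 <= C -> 0 <= r -> r < 1 ->
  (forall k, \int[P]_w (f k w)%:E <= (C * r ^+ k)%:E)%E ->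
  exists2 Z : T -> R, measurable_fun setT Z &
    {ae P, forall w, \sum_(k < n) f k w @[n --> \oo] --> Z w}.
Proof.
move=> mf f0 C0 r0 r1 fC.
pose S w := (\sum_(k <oo) (f k w)%:E)%E.
have mfE k : measurable_fun setT (fun w => (f k w)%:E) by exact/measurable_EFinP.
have S0 w : (0 <= S w)%E by apply: nneseries_ge0 => k _ _; rewrite lee_fin.
have mS : measurable_fun setT S.
  by apply: ge0_emeasurable_sum => // k w _ _; rewrite lee_fin.
have intS : P.-integrable setT S.
  apply/integrableP; split => //.
  under eq_integral do rewrite gee0_abs//.
  rewrite integral_nneseries//; last by move=> k w _; rewrite lee_fin.
  apply: (@le_lt_trans _ _ (C * (1 - r)^-1)%:E); last exact: ltry.
  apply: lime_le.
    by apply: is_cvg_nneseries => k _ _; apply: integral_ge0 => w _; rewrite lee_fin.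
  apply: nearW => n; apply: (@le_trans _ _ (\sum_(0 <= k < n) (C * r ^+ k)%:E)%E).
    by apply: lee_sum => k _.
  by rewrite sumEFin lee_fin -mulr_sumr ler_wpM2l// geometric_sum_le.
exists (fun w => fine (S w)).
  exact: measurableT_comp.
have := integrable_ae measurableT intS; apply: filterS => w /(_ I) Sfin.
have : (\sum_(0 <= k < n) (f k w)%:E)%E @[n --> \oo] --> (fine (S w))%:E.
  rewrite fineK//; apply: is_cvg_nneseries => k _ _; by rewrite lee_fin.
move/fine_cvg; apply: cvg_trans; apply: near_eq_cvg; apply: nearW => n.
by rewrite /= sumEFin /= big_mkord.
Qed.

(** Split into positive and negative parts. *)
Lemma ae_cvg_series (x : nat -> T -> R) (C r : R) :
  (forall k, measurable_fun setT (x k)) -> 0 <= C -> 0 <= r -> r < 1 ->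
  (forall k, \int[P]_w `|x k w|%:E <= (C * r ^+ k)%:E)%E ->
  exists2 Z : T -> R, measurable_fun setT Z &
    {ae P, forall w, \sum_(k < n) x k w @[n --> \oo] --> Z w}.
Proof.
move=> mx C0 r0 r1 xC.
have part (g : R -> R) : measurable_fun setT g ->
    (forall y, 0 <= g y <= `|y|) ->
    exists2 Z : T -> R, measurable_fun setT Z &
    {ae P, forall w, \sum_(k < n) g (x k w) @[n --> \oo] --> Z w}.
  move=> mg g0; have mgx k : measurable_fun setT (fun w => g (x k w)).
    exact: measurableT_comp.
  apply: (@ae_cvg_nonneg_series (fun k w => g (x k w)) C r) => // [k w|k].
    by have /andP[] := g0 (x k w).
  apply: le_trans (xC k); apply: ge0_le_integral => //.
  - by move=> w _; rewrite lee_fin; have /andP[] := g0 (x k w).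
  - exact/measurable_EFinP.
  - by apply/measurable_EFinP; exact: measurableT_comp.
  - by move=> w _; rewrite lee_fin; have /andP[] := g0 (x k w).
have [|y|Zp mZp cvgp] := part (fun y => Num.max y 0).
- by apply: (@measurable_maxr _ _ R setT id (cst 0)).
- by rewrite le_max lexx orbT /= ge_max ler_norm normr_ge0.
have [|y|Zn mZn cvgn] := part (fun y => Num.max (- y) 0).
- have := @measurable_maxr _ R R setT -%R (cst 0).
  by apply => //; exact: oppr_measurable.
- by rewrite le_max lexx orbT /= ge_max -normrN ler_norm normr_ge0.
exists (fun w => Zp w - Zn w); first exact: measurable_funB.
apply: filterS2 cvgp cvgn => w cp cn.
rewrite (_ : (fun n => _) = (fun n => \sum_(k < n) Num.max (x k w) 0
    - \sum_(k < n) Num.max (- x k w) 0)); first exact: cvgB.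
apply/funext => n; rewrite -sumrB; apply: eq_bigr => k _.
have [y0|y0] := leP (x k w) 0; first by rewrite max_l ?oppr_ge0// sub0r opprK.
by rewrite max_r ?subr0// oppr_le0 ltW.
Qed.

End random_series.

(** * Measurability and convergence in the plane *)

Section plane.
Context {R : realType}.
Set Implicit Arguments.
Unset Strict Implicit.

Lemma measurable_plane_add d (T : measurableType d) (f g : T -> R * R) :
  measurable_fun setT f -> measurable_fun setT g ->
  measurable_fun setT (fun w => f w + g w).
Proof.
move=> mf mg; apply: (@measurable_fun_pair _ _ _ _ _ _ (fun w => (f w).1 + (g w).1)
  (fun w => (f w).2 + (g w).2)).
- by apply: measurable_funD; apply: measurableT_comp => //; exact: measurable_fst.
- by apply: measurable_funD; apply: measurableT_comp => //; exact: measurable_snd.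
Qed.

Lemma measurable_plane_scale d (T : measurableType d) (f : T -> R) (v : R * R) :
  measurable_fun setT f -> measurable_fun setT (fun w => f w *: v).
Proof.
move=> mf; apply: (@measurable_fun_pair _ _ _ _ _ _ (fun w => f w * v.1)
  (fun w => f w * v.2)); exact: measurable_funM.
Qed.

Lemma same_law_continuous d1 d2 (T1 : measurableType d1) (T2 : measurableType d2)
    (P1 : probability T1 R) (X1 : T1 -> R * R)
    (P2 : probability T2 R) (X2 : T2 -> R * R) :
  measurable_fun setT X1 -> measurable_fun setT X2 ->
  (forall (f : R * R -> R) (M : R), continuous f -> (forall x, `|f x| <= M) ->
     (\int[P1]_w (f (X1 w))%:E = \int[P2]_w (f (X2 w))%:E)%E) ->
  same_law P1 X1 P2 X2.
Proof.
move=> mX1 mX2 E B mB.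
pose Y1 : {mfun T1 >-> (R * R)%type} := HB.pack X1
  (isMeasurableFun.Build _ _ _ _ _ mX1).
pose Y2 : {mfun T2 >-> (R * R)%type} := HB.pack X2
  (isMeasurableFun.Build _ _ _ _ _ mX2).
apply: (@probability_eq_on_continuous R (distribution P1 Y1) (distribution P2 Y2)) => // f M cf fM.
have mf : measurable_fun setT f by exact: continuous_measurable_plane.
have mEf : measurable_fun setT (EFin \o f) by exact/measurable_EFinP.
rewrite !(@integral_distribution _ _ _ _ _ _ _ (EFin \o f))//.
- exact: E.
- apply: (@integrable_bounded _ _ _ P2 (f \o X2) M) => [|x]; last exact: fM.
  exact: measurableT_comp.
- apply: (@integrable_bounded _ _ _ P1 (f \o X1) M) => [|x]; last exact: fM.
  exact: measurableT_comp.
Qed.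

(** Dominated convergence with a constant bound. *)
Lemma bounded_convergence d (T : measurableType d) (Q : probability T R)
    (X : nat -> T -> R * R) (Xoo : T -> R * R) (f : R * R -> R) (M : R) :
  (forall n, measurable_fun setT (X n)) -> measurable_fun setT Xoo ->
  {ae Q, forall w, X n w @[n --> \oo] --> Xoo w} ->
  continuous f -> (forall x, `|f x| <= M) ->
  (\int[Q]_w (f (X n w))%:E)%E @[n --> \oo] --> (\int[Q]_w (f (Xoo w))%:E)%E.
Proof.
move=> mX mXoo XXoo cf fM.
have mf : measurable_fun setT f by exact: continuous_measurable_plane.
have [| | | | |_ _] := @dominated_convergence _ _ _ Q setT measurableT
    (fun n w => (f (X n w))%:E) (fun w => (f (Xoo w))%:E) (EFin \o cst M).
- by move=> n; apply/measurable_EFinP; exact: measurableT_comp.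
- by apply/measurable_EFinP; exact: measurableT_comp.
- apply: filterS XXoo => w XX _; apply: cvg_EFin; first exact: nearW.
  exact: (cvg_comp _ _ XX (cf (Xoo w))).
- exact: finite_measure_integrable_cst.
- by apply: aeW => x n _ /=; rewrite lee_fin.
by [].
Qed.

End plane.

(** * Product probability spaces *)

Section product.
Context {R : realType} d d' (S : measurableType d) (T : measurableType d')
  (m : probability S R) (P : probability T R).
Set Implicit Arguments.
Unset Strict Implicit.

(** Names the product together with its type of probability, so that it can be
    passed where a probability is expected. *)
Definition prod_prob : probability (S * T)%type R := (m \x P)%E.

Lemma prod_probE A B : measurable A -> measurable B ->
  prod_prob (A `*` B) = (m A * P B)%E.
Proof. exact: product_measure1E. Qed.

Lemma prod_prob_fst A : measurable A -> prod_prob (fst @^-1` A) = m A.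
Proof.
move=> mA; rewrite (_ : fst @^-1` A = A `*` setT); last first.
  by apply/seteqP; split => -[x y] //= [].
by rewrite prod_probE// probability_setT mule1.
Qed.

Lemma prod_prob_snd B : measurable B -> prod_prob (snd @^-1` B) = P B.
Proof.
move=> mB; rewrite (_ : snd @^-1` B = setT `*` B); last first.
  by apply/seteqP; split => -[x y] //= [].
by rewrite prod_probE// probability_setT mul1e.
Qed.

Lemma ae_prod_prob_snd (Q : T -> Prop) : {ae P, forall w, Q w} ->
  {ae prod_prob, forall p, Q p.2}.
Proof.
move=> [N [mN N0 QN]]; exists (snd @^-1` N); split.
- by apply: measurable_fun_preimage => //; exact: measurable_snd.
- by rewrite prod_prob_snd.
- by move=> p /= Qp; apply: QN.
Qed.

Lemma ae_prod_prob_fst (Q : S -> Prop) : {ae m, forall w, Q w} ->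
  {ae prod_prob, forall p, Q p.1}.
Proof.
move=> [N [mN N0 QN]]; exists (fst @^-1` N); split.
- by apply: measurable_fun_preimage => //; exact: measurable_fst.
- by rewrite prod_prob_fst.
- by move=> p /= Qp; apply: QN.
Qed.

End product.

(** * Linear recursions with independent noise *)

Section chain.
Context {R : realType} d (T : measurableType d) (P : probability T R).
Set Implicit Arguments.
Unset Strict Implicit.
Variables (A : 'M[R]_2) (v0 : R * R) (xi : nat -> T -> R).

Definition act (x : R * R) : R * R :=
  (A 0 0 * x.1 + A 0 1 * x.2, A 1 0 * x.1 + A 1 1 * x.2).

Lemma actD x y : act (x + y) = act x + act y.
Proof. by rewrite /act; congr pair => /=; ring. Qed.

Lemma actZ (k : R) x : act (k *: x) = k *: act x.
Proof. by rewrite /act; congr pair => /=; rewrite /GRing.scale /=; ring. Qed.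

Lemma iter_actD n x y : iter n act (x + y) = iter n act x + iter n act y.
Proof. by elim: n => //= n ->; rewrite actD. Qed.

Lemma iter_actZ n (k : R) x : iter n act (k *: x) = k *: iter n act x.
Proof. by elim: n => //= n ->; rewrite actZ. Qed.

Lemma act_sum n (F : nat -> R * R) :
  act (\sum_(k < n) F k) = \sum_(k < n) act (F k).
Proof.
elim: n => [|n IH]; last by rewrite !big_ord_recr /= actD IH.
by rewrite !big_ord0 /act /= !mulr0 addr0.
Qed.

Lemma iter_act_sum m n (F : nat -> R * R) :
  iter m act (\sum_(k < n) F k) = \sum_(k < n) iter m act (F k).
Proof.
elim: m => //= m ->.
exact: (act_sum n (fun k => iter m act (F k))).
Qed.

Fixpoint chain (x : R * R) (z : nat -> R) (n : nat) : R * R :=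
  if n is m.+1 then act (chain x z m) + z m *: v0 else x.

(** The contribution of one unit of noise, [k] steps after it was added. *)
Definition response (k : nat) : R * R := iter k act v0.

(** One more step of the noise series [\sum_k z k *: response k]. *)
Definition superpose (k : nat) (u : R * R) (z : R) : R * R :=
  u + z *: response k.

Lemma drive_superpose u z n :
  drive superpose u z n = u + \sum_(k < n) z k *: response k.
Proof.
elim: n => [|n /= ->]; first by rewrite big_ord0 addr0.
by rewrite big_ord_recr /= addrA.
Qed.

(** The noise added [k] steps before the end has been transported by the
    [k]-th power of the matrix, so the state is a partial sum of the noise
    series read backwards. *)
Lemma chainE x z n :
  chain x z n = drive superpose (iter n act x) (fun k => z (n.-1 - k)%N) n.
Proof.
rewrite drive_superpose; elim: n => [|n /= ->]; first by rewrite big_ord0 addr0.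
rewrite actD -addrA; congr (_ + _).
rewrite (act_sum n (fun k => z (n.-1 - k)%N *: response k)).
rewrite big_ord_recl subn0 addrC; congr (_ + _); apply: eq_bigr => k _.
by rewrite actZ lift0 -subn1 -subnDA add1n.
Qed.

Hypothesis mxi : forall k, measurable_fun setT (xi k).
Hypothesis xi_law : forall k, same_law P (xi k) P (xi 0%N).
Hypothesis xi_ind : forall n, independent_seq P xi n.

(** Unlike the state of the chain, these partial sums converge almost surely. *)
Definition partial_noise (n : nat) (w : T) : R * R :=
  \sum_(k < n) xi k w *: response k.

Lemma measurable_act : measurable_fun setT act.
Proof.
have mrow (a b : R) : measurable_fun setT (fun x : R * R => a * x.1 + b * x.2).
  apply: measurable_funD.
    by apply: measurable_funM => //; exact: measurable_fst.
  by apply: measurable_funM => //; exact: measurable_snd.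
exact: (measurable_fun_pair (mrow _ _) (mrow _ _)).
Qed.

Lemma measurable_iter_act n : measurable_fun setT (iter n act).
Proof.
elim: n => [|n IH]; first exact: measurable_id.
exact: (measurableT_comp measurable_act IH).
Qed.

Lemma measurable_partial_noise n : measurable_fun setT (partial_noise n).
Proof.
elim: n => [|n IH].
  by rewrite (_ : partial_noise 0 = cst 0)//; apply/funext => w;
     rewrite /partial_noise big_ord0.
rewrite (_ : partial_noise n.+1 = (fun w => partial_noise n w + xi n w *: response n)).
  by apply: measurable_plane_add => //; exact: measurable_plane_scale.
by apply/funext => w; rewrite /partial_noise big_ord_recr.
Qed.

Lemma measurable_superpose k : measurable_fun setT (fun p => superpose k p.1 p.2).
Proof.
apply: measurable_plane_add; first exact: measurable_fst.
by apply: measurable_plane_scale; exact: measurable_snd.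
Qed.

Lemma xi_ind_rev n : independent_seq P (fun k => xi (n.-1 - k)%N) n.
Proof.
move=> C mC; rewrite (reindex_inj rev_ord_inj) [RHS](reindex_inj rev_ord_inj) /=.
have E (k : 'I_n) : (n.-1 - (n - k.+1))%N = k.
  by case: n k => [[]//|n] k /=; rewrite subSS subKn// -ltnS.
under eq_bigr do rewrite E.
under [RHS]eq_bigr do rewrite E.
exact: (@xi_ind n _ (fun k => mC (n - k.+1)%N)).
Qed.

(** The starting point lives on one factor of the product space, the noise on
    the other. *)
Lemma independent_start d' (S : measurableType d') (m : probability S R)
    (f : S -> R * R) (z : nat -> T -> R) n :
  measurable_fun setT f -> (forall k, measurable_fun setT (z k)) ->
  independent_seq P z n ->
  independent_prefix (prod_prob m P) (fun p => f p.1) (fun k p => z k p.2) n.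
Proof.
move=> mf mz ind B C mB mC.
have mB' : measurable (f @^-1` B) by exact: measurable_fun_preimage.
have mC' k : measurable (z k @^-1` C k) by exact: measurable_fun_preimage.
rewrite (_ : \big[setI/setT]_(k < n) _ =
    snd @^-1` (\big[setI/setT]_(k < n) (z k @^-1` C k))); last first.
  rewrite -(bigcap_mkord n (fun k => (fun p : S * T => z k p.2) @^-1` C k)).
  by rewrite -(bigcap_mkord n (fun k => z k @^-1` C k)) preimage_bigcap.
have mbig : measurable (\big[setI/setT]_(k < n) (z k @^-1` C k)).
  by apply: big_ind => //; exact: measurableI.
have -> : (fun p : S * T => f p.1) @^-1` B = fst @^-1` (f @^-1` B) by [].
rewrite (_ : _ `&` _ = (f @^-1` B) `*` \big[setI/setT]_(k < n) (z k @^-1` C k))//.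
rewrite prod_probE// ind// prod_prob_fst//; congr (_ * _)%E.
by apply: eq_bigr => k _; rewrite -(prod_prob_snd m P (mC' k)).
Qed.

(** Reversing the order of the noise does not change its joint law, and turns
    the chain into a partial sum of the noise series. *)
Lemma chain_law (m : probability (R * R)%type R) n :
  same_law (prod_prob m P) (fun p => chain p.1 (xi ^~ p.2) n)
           (prod_prob m P) (fun p => iter n act p.1 + partial_noise n p.2).
Proof.
have mfst : measurable_fun setT (fun p : (R * R) * T => iter n act p.1).
  exact: (measurableT_comp (measurable_iter_act n) measurable_fst).
have msnd (k : nat) : measurable_fun setT (fun p : (R * R) * T => xi k p.2).
  exact: (measurableT_comp (mxi k) measurable_snd).
have -> : (fun p => chain p.1 (xi ^~ p.2) n) = (fun p : (R * R) * T =>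
    drive superpose (iter n act p.1) (fun k => xi (n.-1 - k)%N p.2) n).
  by apply/funext => p; rewrite chainE.
have -> : (fun p => iter n act p.1 + partial_noise n p.2) = (fun p : (R * R) * T =>
    drive superpose (iter n act p.1) (fun k => xi k p.2) n).
  by apply/funext => p; rewrite drive_superpose.
apply: (@same_law_drive R _ _ _ _ _ (R * R)%type (prod_prob m P) (prod_prob m P)
  (fun p => iter n act p.1) (fun p => iter n act p.1)
  (fun k p => xi (n.-1 - k)%N p.2) (fun k p => xi k p.2) superpose n) => //.
- exact: measurable_superpose.
- apply: (independent_start m (f := iter n act) (z := fun k => xi (n.-1 - k)%N)) => //.
    exact: measurable_iter_act.
  exact: xi_ind_rev.
- apply: (independent_start m (f := iter n act) (z := xi)) => //.
  exact: measurable_iter_act.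
- move=> k _ B mB.
  have mB' j : measurable (xi j @^-1` B) by exact: measurable_fun_preimage.
  rewrite (prod_prob_snd m P (mB' _)) (prod_prob_snd m P (mB' k)).
  by rewrite (xi_law _ mB) (xi_law k mB).
Qed.

(** Put the [n] fresh noise terms first and the [M] old ones, delayed by [n],
    after them: the concatenation is again an independent sequence with the
    same marginals. *)
Lemma partial_noise_shift n M :
  same_law (prod_prob P P)
    (fun p => iter n act (partial_noise M p.1) + partial_noise n p.2)
    P (partial_noise (n + M)).
Proof.
pose zeta k (p : T * T) := if (k < n)%N then xi k p.2 else xi (k - n)%N p.1.
have mzeta k : measurable_fun setT (zeta k).
  rewrite /zeta; case: (k < n)%N.
    exact: (measurableT_comp (mxi _) measurable_snd).
  exact: (measurableT_comp (mxi _) measurable_fst).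
have zeta_law k B : measurable B -> prod_prob P P (zeta k @^-1` B) = P (xi k @^-1` B).
  move=> mB; have mB' j : measurable (xi j @^-1` B).
    exact: measurable_fun_preimage.
  rewrite /zeta; case: (k < n)%N; first exact: (prod_prob_snd P P (mB' _)).
  by rewrite (prod_prob_fst P P (mB' _)) (xi_law _ mB) (xi_law k mB).
have zeta_ind : independent_seq (prod_prob P P) zeta (n + M).
  move=> C mC; rewrite !big_split_ord /=.
  under [X in _ = (_ * X)%E]eq_bigr do rewrite zeta_law//.
  under [X in _ = (X * _)%E]eq_bigr do rewrite zeta_law//.
  pose E := \big[setI/setT]_(k < M) (xi k @^-1` C (n + k)%N).
  pose F := \big[setI/setT]_(k < n) (xi k @^-1` C k).
  have mE : measurable E.
    apply: big_ind => //; first exact: measurableI.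
    by move=> k _; exact: measurable_fun_preimage.
  have mF : measurable F.
    apply: big_ind => //; first exact: measurableI.
    by move=> k _; exact: measurable_fun_preimage.
  rewrite (_ : _ `&` _ = E `*` F).
    rewrite prod_probE// muleC; congr (_ * _)%E; first exact: (@xi_ind n C mC).
    rewrite (@xi_ind M _ (fun k => mC (n + k)%N)); apply: eq_bigr => k _.
    by rewrite (xi_law _ (mC _)) (xi_law (n + k) (mC _)).
  have -> : E `*` F = fst @^-1` E `&` snd @^-1` F by [].
  rewrite setIC; congr (_ `&` _).
    rewrite -(bigcap_mkord M (fun k => zeta (n + k)%N @^-1` C (n + k)%N)).
    rewrite /E -(bigcap_mkord M (fun k => xi k @^-1` C (n + k)%N)) preimage_bigcap.
    apply: eq_bigcapr => k _; apply/seteqP; split => p /=;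
      by rewrite /zeta ltnNge leq_addr /= addKn.
  rewrite /F -(bigcap_mkord n (fun k => xi k @^-1` C k)) preimage_bigcap.
  rewrite -(bigcap_mkord n (fun k => zeta k @^-1` C k)).
  by apply: eq_bigcapr => k /= kn; apply/seteqP; split => p /=; rewrite /zeta kn.
have -> : (fun p => iter n act (partial_noise M p.1) + partial_noise n p.2) =
    (fun p : T * T => drive superpose (cst 0 p) (zeta ^~ p) (n + M)).
  apply/funext => p; rewrite drive_superpose add0r big_split_ord /= addrC.
  rewrite /partial_noise.
  congr (_ + _); last by apply: eq_bigr => k _; rewrite /zeta ltn_ord.
  rewrite (iter_act_sum n M (fun k => xi k p.1 *: response k)).
  apply: eq_bigr => k _; rewrite iter_actZ /response -iterD.
  by rewrite /zeta ltnNge leq_addr /= addKn.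
have -> : partial_noise (n + M) =
    (fun w => drive superpose (cst 0 w) (xi ^~ w) (n + M)).
  by apply/funext => w; rewrite drive_superpose add0r.
apply: (@same_law_drive R _ _ _ _ _ (R * R)%type (prod_prob P P) P
  (cst 0) (cst 0) zeta xi superpose (n + M)) => //.
- exact: measurable_superpose.
- exact: independent_prefix_cst.
- exact: independent_prefix_cst.
- by move=> B _; rewrite !preimage_cst; case: ifP => _; rewrite ?probability_setT ?measure0.
- by move=> k _ B; exact: zeta_law.
Qed.

Variable Yoo : T -> R * R.
Hypothesis mYoo : measurable_fun setT Yoo.
Hypothesis partial_noise_cvg :
  {ae P, forall w, partial_noise n w @[n --> \oo] --> Yoo w}.
Hypothesis iter_act_cvg : forall x, iter n act x @[n --> \oo] --> (0 : R * R).

Lemma act_continuous : continuous act.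
Proof.
have crow (a b : R) : continuous (fun x : R * R => a * x.1 + b * x.2).
  move=> x; apply: cvgD.
    by apply: cvgM; [exact: cvg_cst|exact: cvg_fst].
  by apply: cvgM; [exact: cvg_cst|exact: cvg_snd].
by move=> x; exact: (cvg_pair (crow _ _ x) (crow _ _ x)).
Qed.

Lemma iter_act_continuous n : continuous (iter n act).
Proof.
elim: n => [|n IH] x; first exact: cvg_id.
by apply: continuous_comp; [exact: IH|exact: act_continuous].
Qed.

Lemma measurable_chain n :
  measurable_fun setT (fun p : (R * R) * T => chain p.1 (xi ^~ p.2) n).
Proof.
elim: n => [|n IH]; first exact: measurable_fst.
apply: measurable_plane_add.
  exact: (measurableT_comp measurable_act IH).
apply: measurable_plane_scale.
exact: (measurableT_comp (mxi n) measurable_snd).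
Qed.

Lemma integral_chain (m : probability (R * R)%type R) (f : R * R -> R) (M : R) n :
  continuous f -> (forall x, `|f x| <= M) ->
  (\int[m]_x \int[P]_w (f (chain x (xi ^~ w) n))%:E =
   \int[prod_prob m P]_p (f (iter n act p.1 + partial_noise n p.2))%:E)%E.
Proof.
move=> cf fM; have mf := continuous_measurable_plane cf.
have := @integral12_prod_meas1 _ _ _ _ R m P
  (fun p => (f (chain p.1 (xi ^~ p.2) n))%:E).
rewrite /fubini_F => ->.
  apply: (same_law_integral _ _ (chain_law m n) mf fM).
    exact: measurable_chain.
  apply: measurable_plane_add.
    exact: (measurableT_comp (measurable_iter_act n) measurable_fst).
  exact: (measurableT_comp (measurable_partial_noise n) measurable_snd).
apply: (@integrable_bounded _ _ _ (prod_prob m P)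
  (fun p => f (chain p.1 (xi ^~ p.2) n)) M) => //.
exact: (measurableT_comp mf (measurable_chain n)).
Qed.

(** The chain started from any law converges in law to the noise series: by
    [chain_law] its law at time [n] is that of [A^n x] plus a partial sum, and
    the first term tends to 0. *)
Lemma chain_cvg (m : probability (R * R)%type R) (f : R * R -> R) (M : R) :
  continuous f -> (forall x, `|f x| <= M) ->
  (\int[m]_x \int[P]_w (f (chain x (xi ^~ w) n))%:E)%E @[n --> \oo] -->
  (\int[P]_w (f (Yoo w))%:E)%E.
Proof.
move=> cf fM; have mf := continuous_measurable_plane cf.
have mY2 : measurable_fun setT (fun p : (R * R) * T => Yoo p.2).
  exact: (measurableT_comp mYoo measurable_snd).
have -> : (\int[P]_w (f (Yoo w))%:E = \int[prod_prob m P]_p (f (Yoo p.2))%:E)%E.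
  apply/esym; apply: (same_law_integral mY2 mYoo _ mf fM) => B mB.
  exact: (prod_prob_snd m P (measurable_fun_preimage mYoo mB)).
rewrite (_ : (fun n => _) = (fun n =>
  \int[prod_prob m P]_p (f (iter n act p.1 + partial_noise n p.2))%:E)%E); last first.
  by apply/funext => n; exact: (integral_chain m n cf fM).
apply: (bounded_convergence (X := fun n (p : (R * R) * T) =>
  iter n act p.1 + partial_noise n p.2) _ mY2 _ cf fM).
- move=> n; apply: measurable_plane_add.
    exact: (measurableT_comp (measurable_iter_act n) measurable_fst).
  exact: (measurableT_comp (measurable_partial_noise n) measurable_snd).
- apply: filterS (ae_prod_prob_snd m partial_noise_cvg) => p cvgp.
  by rewrite -[Yoo _]add0r; exact: cvgD.
Qed.

(** Let the number of old terms tend to infinity in [partial_noise_shift]: one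
    side tends to the chain started from the law of the series, the other to
    the series itself. *)
Lemma stationary_chain (m : probability (R * R)%type R) (f : R * R -> R) (M : R) n :
  (forall B, measurable B -> m B = P (Yoo @^-1` B)) ->
  continuous f -> (forall x, `|f x| <= M) ->
  (\int[m]_x \int[P]_w (f (chain x (xi ^~ w) n))%:E =
   \int[P]_w (f (Yoo w))%:E)%E.
Proof.
move=> mE cf fM; have mf := continuous_measurable_plane cf.
have mN k : measurable_fun setT (fun p : T * T => partial_noise k p.2).
  exact: (measurableT_comp (measurable_partial_noise k) measurable_snd).
have mYn : measurable_fun setT (fun p : T * T => iter n act (Yoo p.1)).
  apply: (measurableT_comp (measurable_iter_act n)).
  exact: (measurableT_comp mYoo measurable_fst).
rewrite (integral_chain m n cf fM).
transitivity (\int[prod_prob P P]_p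
    (f (iter n act (Yoo p.1) + partial_noise n p.2))%:E)%E.
  have madd : measurable_fun setT (fun q : (R * R) * (R * R) => iter n act q.1 + q.2).
    apply: measurable_plane_add; last exact: measurable_snd.
    exact: (measurableT_comp (measurable_iter_act n) measurable_fst).
  have mY1 : measurable_fun setT (fun p : T * T => Yoo p.1).
    exact: (measurableT_comp mYoo measurable_fst).
  have mN' : measurable_fun setT (fun p : (R * R) * T => partial_noise n p.2).
    exact: (measurableT_comp (measurable_partial_noise n) measurable_snd).
  have pair_law : same_law (prod_prob m P) (fun p => (p.1, partial_noise n p.2))
                           (prod_prob P P) (fun p => (Yoo p.1, partial_noise n p.2)).
    apply: (same_law_pair measurable_fst mN' mY1 (mN n)) => B C mB mC.
    have mC' := measurable_fun_preimage (measurable_partial_noise n) mC.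
    have mB' := measurable_fun_preimage mYoo mB.
    rewrite (_ : _ `&` _ = B `*` (partial_noise n @^-1` C))//.
    rewrite (_ : _ @^-1` B `&` _ = (Yoo @^-1` B) `*` (partial_noise n @^-1` C))//.
    by rewrite !prod_probE// mE.
  have := same_law_comp madd pair_law.
  move=> E; apply: (same_law_integral _ _ E mf fM).
    apply: measurable_plane_add => //.
    exact: (measurableT_comp (measurable_iter_act n) measurable_fst).
  exact: (measurable_plane_add mYn (mN n)).
have mNM M' : measurable_fun setT
    (fun p : T * T => iter n act (partial_noise M' p.1) + partial_noise n p.2).
  apply: measurable_plane_add => //; apply: (measurableT_comp (measurable_iter_act n)).
  exact: (measurableT_comp (measurable_partial_noise M') measurable_fst).
have lim1 : (\int[P]_w (f (partial_noise (n + k) w))%:E)%E @[k --> \oo] -->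
    (\int[P]_w (f (Yoo w))%:E)%E.
  apply: (bounded_convergence (X := fun k => partial_noise (n + k)) _ mYoo _ cf fM).
    by move=> k; exact: measurable_partial_noise.
  apply: filterS partial_noise_cvg => w cw.
  exact: (cvg_comp _ _ (cvg_addnl n) cw).
have lim2 : (\int[prod_prob P P]_p (f (iter n act (partial_noise k p.1)
    + partial_noise n p.2))%:E)%E @[k --> \oo] -->
    (\int[prod_prob P P]_p (f (iter n act (Yoo p.1) + partial_noise n p.2))%:E)%E.
  apply: (bounded_convergence (X := fun k (p : T * T) => iter n act (partial_noise k p.1)
    + partial_noise n p.2) _ _ _ cf fM) => //.
    exact: measurable_plane_add.
  apply: filterS (ae_prod_prob_fst P partial_noise_cvg) => p cp.
  apply: cvgD; last exact: cvg_cst.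
  exact: (cvg_comp _ _ cp (iter_act_continuous (n := n) (x := Yoo p.1))).
apply: (cvg_unique _ lim2) => //.
rewrite (_ : (fun k => _) = (fun k => \int[P]_w (f (partial_noise (n + k) w))%:E)%E)//.
apply/funext => k.
apply: (same_law_integral (mNM k) _ (partial_noise_shift n k) mf fM).
exact: measurable_partial_noise.
Qed.

End chain.

(** * Limits and moments of normal laws *)

Section gaussian.
Context {R : realType}.
Set Implicit Arguments.
Unset Strict Implicit.

(** Homotheties of the standard normal law depend continuously on the ratio;
    the line is embedded in the plane to reuse the two-dimensional criterion. *)
Lemma normal_law_limit d (T : measurableType d) (P : probability T R)
    (Z : nat -> T -> R) (Zoo : T -> R) (s : nat -> R) (soo : R) :
  (forall n, measurable_fun setT (Z n)) -> measurable_fun setT Zoo ->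
  {ae P, forall w, Z n w @[n --> \oo] --> Zoo w} ->
  (forall n, same_law P (Z n) std_normal ( *%R (s n))) ->
  s n @[n --> \oo] --> soo ->
  same_law P Zoo std_normal ( *%R soo).
Proof.
move=> mZ mZoo ZZ Zlaw ss.
pose emb (x : R) : R * R := (x, 0).
have memb : measurable_fun setT emb by exact: measurable_fun_pair.
have mmul (a : R) : measurable_fun setT ( *%R a : R -> R).
  exact: mulrl_measurable.
have lawE : same_law P (emb \o Zoo) std_normal (emb \o *%R soo).
  apply: same_law_continuous.
  - exact: measurableT_comp.
  - exact: measurableT_comp.
  move=> f M cf fM; have mf := continuous_measurable_plane cf.
  have lim1 : (\int[P]_w (f (emb (Z n w)))%:E)%E @[n --> \oo] -->
      (\int[P]_w (f (emb (Zoo w)))%:E)%E.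
    apply: (bounded_convergence (X := fun n w => emb (Z n w)) _ _ _ cf fM) => //.
    - by move=> n; exact: (measurableT_comp memb (mZ n)).
    - exact: (measurableT_comp memb mZoo).
    - apply: filterS ZZ => w Zw; exact: (cvg_pair Zw (cvg_cst 0)).
  have lim2 : (\int[std_normal]_x (f (emb (s n * x)))%:E)%E @[n --> \oo] -->
      (\int[std_normal]_x (f (emb (soo * x)))%:E)%E.
    apply: (bounded_convergence (X := fun n x => emb (s n * x)) _ _ _ cf fM) => //.
    - by move=> n; exact: (measurableT_comp memb (mmul (s n))).
    - exact: (measurableT_comp memb (mmul soo)).
    - apply: aeW => x; exact: (cvg_pair (cvgM ss (cvg_cst x)) (cvg_cst 0)).
  apply: (cvg_unique _ lim1) => //.
  rewrite (_ : (fun n => _) = (fun n => \int[std_normal]_x (f (emb (s n * x)))%:E)%E)//.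
  apply/funext => n.
  apply: (same_law_integral (mZ n) (mmul (s n)) (Zlaw n)
    (f := f \o emb) _ (fun x => fM (emb x))).
  exact: measurableT_comp.
exact: (same_law_comp measurable_fst lawE).
Qed.

Lemma same_law_integrable d1 d2 d (T1 : measurableType d1) (T2 : measurableType d2)
    (S : measurableType d) (P1 : probability T1 R) (X1 : T1 -> S)
    (P2 : probability T2 R) (X2 : T2 -> S) (g : S -> R) :
  measurable_fun setT X1 -> measurable_fun setT X2 -> same_law P1 X1 P2 X2 ->
  measurable_fun setT g -> P2.-integrable setT (fun w => (g (X2 w))%:E) ->
  P1.-integrable setT (fun w => (g (X1 w))%:E) /\
  (\int[P1]_w (g (X1 w))%:E = \int[P2]_w (g (X2 w))%:E)%E.
Proof.
move=> mX1 mX2 X12 mg int2.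
have mEg : measurable_fun setT (EFin \o g) by exact/measurable_EFinP.
have transfer (h : S -> \bar R) : measurable_fun setT h -> (forall y, 0 <= h y)%E ->
    (\int[P1]_w h (X1 w) = \int[P2]_w h (X2 w))%E.
  move=> mh h0.
  rewrite -(@ge0_integral_pushforward _ _ _ _ R X1 mX1 P1 setT h)//.
  rewrite -(@ge0_integral_pushforward _ _ _ _ R X2 mX2 P2 setT h)//.
  by apply: eq_measure_integral => B mB _; exact: X12.
have int1 : P1.-integrable setT (fun w => (g (X1 w))%:E).
  apply/integrableP; split; first exact: (measurableT_comp mEg mX1).
  rewrite (transfer (fun y => `|(g y)%:E|%E))//.
    by have /integrableP[] := int2.
  by apply: measurableT_comp.
split => //.
rewrite -(@integral_pushforward _ _ _ _ R X1 mX1 P1 setT (EFin \o g))//.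
rewrite -(@integral_pushforward _ _ _ _ R X2 mX2 P2 setT (EFin \o g))//.
by apply: eq_measure_integral => B mB _; exact: X12.
Qed.

Lemma normal_law_moments d (T : measurableType d) (P : probability T R)
    (L : T -> R) (s : R) :
  measurable_fun setT L -> same_law P L std_normal ( *%R s) ->
  [/\ P.-integrable setT (fun w => (L w)%:E),
      (\int[P]_w (L w)%:E = 0)%E,
      P.-integrable setT (fun w => (L w ^+ 2)%:E) &
      (\int[P]_w (L w ^+ 2)%:E = (s ^+ 2)%:E)%E].
Proof.
move=> mL Ls.
have ms : measurable_fun setT ( *%R s : R -> R) by exact: mulrl_measurable.
have i1 : std_normal.-integrable setT (fun x => (s * x)%:E).
  under eq_fun do rewrite EFinM.
  by apply: integrableZl => //; exact: integrable_std_normal.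
have i2 : std_normal.-integrable setT (fun x => ((s * x) ^+ 2)%:E).
  under eq_fun do rewrite exprMn EFinM.
  by apply: integrableZl => //; exact: integrable_sqr_std_normal.
have [||I1 E1] := same_law_integrable (g := id) mL ms Ls => //.
have [||I2 E2] := same_law_integrable (g := fun x : R => x ^+ 2) mL ms Ls => //.
split => //.
- rewrite E1; under eq_integral do rewrite EFinM.
  by rewrite (integralZl measurableT integrable_std_normal) mean_std_normal mule0.
- rewrite E2; under eq_integral do rewrite exprMn EFinM.
  rewrite (integralZl measurableT integrable_sqr_std_normal).
  by rewrite second_moment_std_normal mule1.
Qed.

(** All linear projections are centred normal with variance a quadratic form;
    the covariances follow from the variances by polarization. *)
Lemma centered_gaussian2_of_projections (S : 'M[R]_2) (mu : probability (R * R)%type R) :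
  S 0 1 = S 1 0 ->
  (forall u v, 0 <= u ^+ 2 * S 0 0 + 2 * u * v * S 0 1 + v ^+ 2 * S 1 1) ->
  (forall u v, same_law mu (fun x => u * x.1 + v * x.2) std_normal
    ( *%R (Num.sqrt (u ^+ 2 * S 0 0 + 2 * u * v * S 0 1 + v ^+ 2 * S 1 1)))) ->
  centered_gaussian2 S mu.
Proof.
move=> Ssym q0 law.
have mlin (u v : R) : measurable_fun setT (fun x : R * R => u * x.1 + v * x.2).
  apply: measurable_funD.
    by apply: measurable_funM => //; exact: measurable_fst.
  by apply: measurable_funM => //; exact: measurable_snd.
have moments u v := normal_law_moments (mlin u v) (law u v).
have [i10 e10 i20 s20] := moments 1 0.
have [i01 e01 i02 s02] := moments 0 1.
have [_ _ i11 s11] := moments 1 1.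
rewrite sqr_sqrtr// in s20; rewrite sqr_sqrtr// in s02; rewrite sqr_sqrtr// in s11.
have E1 : (\int[mu]_x x.1%:E = 0)%E.
  by rewrite -e10; apply: eq_integral => x _; rewrite mul1r mul0r addr0.
have E2 : (\int[mu]_x x.2%:E = 0)%E.
  by rewrite -e01; apply: eq_integral => x _; rewrite mul1r mul0r add0r.
have S1 : (\int[mu]_x (x.1 ^+ 2)%:E = (S 0 0)%:E)%E.
  rewrite (_ : S 0 0 = 1 ^+ 2 * S 0 0 + 2 * 1 * 0 * S 0 1 + 0 ^+ 2 * S 1 1); last by ring.
  by rewrite -s20; apply: eq_integral => x _; rewrite mul1r mul0r addr0.
have S2 : (\int[mu]_x (x.2 ^+ 2)%:E = (S 1 1)%:E)%E.
  rewrite (_ : S 1 1 = 0 ^+ 2 * S 0 0 + 2 * 0 * 1 * S 0 1 + 1 ^+ 2 * S 1 1); last by ring.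
  by rewrite -s02; apply: eq_integral => x _; rewrite mul1r mul0r add0r.
have j1 : mu.-integrable setT (fun x : R * R => (x.1 ^+ 2)%:E).
  by apply: eq_integrable i20 => // x _; rewrite mul1r mul0r addr0.
have j2 : mu.-integrable setT (fun x : R * R => (x.2 ^+ 2)%:E).
  by apply: eq_integrable i02 => // x _; rewrite mul1r mul0r add0r.
have S12 : (\int[mu]_x (x.1 * x.2)%:E = (S 0 1)%:E)%E.
  pose c : R := 2^-1.
  have -> : (fun x : R * R => (x.1 * x.2)%:E) = (fun x => c%:E *
      ((1 * x.1 + 1 * x.2) ^+ 2)%R%:E
      - (c%:E * (x.1 ^+ 2)%R%:E + c%:E * (x.2 ^+ 2)%R%:E))%E.
    apply/funext => x /=; rewrite -!EFinM -!EFinD /c; congr EFin.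
    by field.
  rewrite integralB//; last 2 first.
  - exact: integrableZl.
  - by apply: integrableD => //; exact: integrableZl.
  rewrite integralD//; last 2 first.
  - exact: integrableZl.
  - exact: integrableZl.
  rewrite !integralZl// S1 S2 s11 -!EFinM -!EFinD /c; congr EFin.
  by field.
have expE (f : R * R -> R) : ('E_mu[f] = \int[mu]_x (f x)%:E)%E by rewrite unlock.
have covE (f g : R * R -> R) : (\int[mu]_x (f x)%:E = 0)%E ->
    (\int[mu]_x (g x)%:E = 0)%E -> covariance mu f g = (\int[mu]_x (f x * g x)%:E)%E.
  move=> f0 g0; rewrite unlock !expE f0 g0 /=; apply: eq_integral => x _.
  by rewrite fctE /= !subr0.
split.
- move=> u v; exists 0, (Num.sqrt (u ^+ 2 * S 0 0 + 2 * u * v * S 0 1 + v ^+ 2 * S 1 1)).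
  by move=> B mB; rewrite -std_normalE//; exact: law.
- by rewrite !expE.
- by rewrite covE.
- split; first by rewrite covE.
  by rewrite covE// -Ssym -S12; apply: eq_integral => x _; rewrite mulrC.
- by rewrite covE.
Qed.

End gaussian.

(** * A quadratic energy decreasing along the scheme *)

Section energy.
Context {R : realType}.
Set Implicit Arguments.
Unset Strict Implicit.

(** For the damped oscillator [p' = - q - nu p, q' = p] the energy [p^2 + q^2]
    is dissipated only through [p]; the cross term transfers the dissipation to
    [q]. *)
Definition energy (delta : R) (x : R * R) : R :=
  x.1 ^+ 2 + delta * x.1 * x.2 + x.2 ^+ 2.

Lemma energy_bounds (delta : R) x : 0 <= delta <= 1 ->
  (x.1 ^+ 2 + x.2 ^+ 2) / 2 <= energy delta x <= 2 * (x.1 ^+ 2 + x.2 ^+ 2).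
Proof.
case: x => p q /andP[d0 d1]; rewrite /energy /=.
have pq : `|p * q| <= (p ^+ 2 + q ^+ 2) / 2.
  rewrite ler_norml; apply/andP; split.
    by have := sqr_ge0 (p + q); nra.
  by have := sqr_ge0 (p - q); nra.
have dpq : `|delta * p * q| <= (p ^+ 2 + q ^+ 2) / 2.
  rewrite -mulrA normrM (ger0_norm d0); apply: le_trans pq.
  by rewrite ler_piMl.
move: dpq; rewrite ler_norml => /andP[l u].
have s : 0 <= p ^+ 2 + q ^+ 2 by rewrite addr_ge0 ?sqr_ge0.
by apply/andP; split; lra.
Qed.

(** A negative definite form stays so when its coefficients are perturbed; half
    of the margin [delta / 2] is left. *)
Lemma quadratic_form_le (delta c11 c12 c22 d11 d12 d22 p q : R) :
  `|c11 - d11| <= delta / 8 -> `|c12 - d12| <= delta / 8 -> `|c22 - d22| <= delta / 8 ->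
  d11 * p ^+ 2 + d12 * (p * q) + d22 * q ^+ 2 <= - (delta / 2) * (p ^+ 2 + q ^+ 2) ->
  c11 * p ^+ 2 + c12 * (p * q) + c22 * q ^+ 2 <= - (delta / 4) * (p ^+ 2 + q ^+ 2).
Proof.
move=> h11 h12 h22 hd.
have delta0 : 0 <= delta by have := normr_ge0 (c11 - d11); lra.
have pq : `|p * q| <= (p ^+ 2 + q ^+ 2) / 2.
  rewrite ler_norml; apply/andP; split.
    by have := sqr_ge0 (p + q); nra.
  by have := sqr_ge0 (p - q); nra.
have e11 : (c11 - d11) * p ^+ 2 <= delta / 8 * p ^+ 2.
  by rewrite ler_wpM2r ?sqr_ge0// (le_trans (ler_norm _)).
have e22 : (c22 - d22) * q ^+ 2 <= delta / 8 * q ^+ 2.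
  by rewrite ler_wpM2r ?sqr_ge0// (le_trans (ler_norm _)).
have e12 : (c12 - d12) * (p * q) <= delta / 8 * ((p ^+ 2 + q ^+ 2) / 2).
  by rewrite (le_trans (ler_norm _))// normrM ler_pM.
have p2 := sqr_ge0 p; have q2 := sqr_ge0 q.
have := mulr_ge0 delta0 p2; have := mulr_ge0 delta0 q2; move: hd e11 e22 e12.
move: (p ^+ 2) (q ^+ 2) (p * q) => P2 Q2 PQ; nra.
Qed.

(** Derivative of the energy along the damped oscillator. The difference of the
    two sides is a sum of squares of [q + nu p] and [p], for this value of
    [delta]. *)
Lemma damped_form_le (nu delta p q : R) : 0 < nu ->
  delta = 4 * nu / (4 + nu ^+ 2) ->
  (- 2 * nu + delta) * p ^+ 2 + (- (delta * nu)) * (p * q) + (- delta) * q ^+ 2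
  <= - (delta / 2) * (p ^+ 2 + q ^+ 2).
Proof.
move=> nu0 ->; have D0 : 0 < 4 + nu ^+ 2 by rewrite ltr_pwDl ?sqr_ge0.
rewrite -subr_ge0.
rewrite (_ : _ - _ = nu / (4 + nu ^+ 2) * (2 * (q + nu * p) ^+ 2 + 2 * p ^+ 2)); last first.
  by field; rewrite gt_eqF.
apply: mulr_ge0; first by apply: divr_ge0; exact: ltW.
by apply: addr_ge0; apply: mulr_ge0 => //; exact: sqr_ge0.
Qed.


Lemma first_order_cvg (a : R -> R) (l : R) (K : R) :
  (\forall h \near 0^'+, `|a h - l * h| <= K * h ^+ 2) ->
  a h / h @[h --> 0^'+] --> l.
Proof.
move=> aK; have h_gt0 : \forall h \near (0:R)^'+, 0 < h by exact: nbhs_right_gt.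
have K0 : K * h @[h --> (0:R)^'+] --> (0 : R).
  rewrite -[X in _ --> X](mulr0 K); apply: cvgM; first exact: cvg_cst.
  by apply: cvg_at_right_filter; exact: cvg_id.
have KN : - (K * h) @[h --> (0:R)^'+] --> (0 : R) by rewrite -[X in _ --> X]oppr0; exact: cvgN.
apply/subr_cvg0.
apply: (squeeze_cvgr _ KN K0).
near=> h; rewrite -ler_norml.
have h0 : 0 < h by near: h.
rewrite (_ : a h / h - l = (a h - l * h) / h); last by field; rewrite gt_eqF.
rewrite normrM normfV (gtr0_norm h0) ler_pdivrMr// -mulrA -expr2.
by near: h.
Unshelve. all: by end_near. Qed.

Lemma near_dist_le (f : R -> R) (l e : R) : 0 < e -> f h @[h --> 0^'+] --> l ->
  \forall h \near 0^'+, `|f h - l| <= e.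
Proof.
by move=> e0 /cvgr_dist_le fl; near=> h; rewrite distrC; near: h; exact: fl.
Unshelve. all: by end_near. Qed.

Section scheme.
Variables (nu : R) (A : R -> 'M[R]_2).
Hypothesis nu_gt0 : 0 < nu.
Hypothesis nu_neq2 : nu != 2.
Hypothesis hA : (fun h : R => `|A h 0 0 - 1 + nu * h| + `|A h 0 1 + h|
                      + `|A h 1 0 - h| + `|A h 1 1 - 1|)
        =O_ (0^'+) (fun h : R => h ^+ 2).

(** The entries of [(A - 1) / h]. They converge to those of the matrix of the
    damped oscillator, so estimates for small [h] become continuity arguments. *)
Let al h := (A h 0 0 - 1) / h.
Let be h := A h 0 1 / h.
Let ga h := A h 1 0 / h.
Let de h := (A h 1 1 - 1) / h.

Lemma scheme_rates : exists K : R, \forall h \near 0^'+,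
  [/\ `|A h 0 0 - 1 - (- nu) * h| <= K * h ^+ 2, `|A h 0 1 - (- 1) * h| <= K * h ^+ 2,
      `|A h 1 0 - 1 * h| <= K * h ^+ 2 & `|A h 1 1 - 1 - 0 * h| <= K * h ^+ 2].
Proof.
move/eqO_exP : hA => [K K0 hK]; exists K; near=> h.
have : `| `|A h 0 0 - 1 + nu * h| + `|A h 0 1 + h| + `|A h 1 0 - h| + `|A h 1 1 - 1| |
    <= K * `|h ^+ 2| by near: h.
rewrite !mulNr !opprK !mul1r mul0r subr0 (ger0_norm (sqr_ge0 h)) ger0_norm ?addr_ge0//.
have n1 := normr_ge0 (A h 0 0 - 1 + nu * h); have n2 := normr_ge0 (A h 0 1 + h).
have n3 := normr_ge0 (A h 1 0 - h); have n4 := normr_ge0 (A h 1 1 - 1).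
by move=> le; split; lra.
Unshelve. all: by end_near. Qed.

Let al_cvg : al h @[h --> 0^'+] --> - nu.
Proof.
have [K hK] := scheme_rates; apply: (@first_order_cvg (fun h => A h 0 0 - 1) _ K).
by apply: filterS hK => h [].
Qed.

Let be_cvg : be h @[h --> 0^'+] --> (-1 : R).
Proof.
have [K hK] := scheme_rates; apply: (@first_order_cvg (fun h => A h 0 1) _ K).
by apply: filterS hK => h [].
Qed.

Let ga_cvg : ga h @[h --> 0^'+] --> (1 : R).
Proof.
have [K hK] := scheme_rates; apply: (@first_order_cvg (fun h => A h 1 0) _ K).
by apply: filterS hK => h [].
Qed.

Let de_cvg : de h @[h --> 0^'+] --> (0 : R).
Proof.
have [K hK] := scheme_rates; apply: (@first_order_cvg (fun h => A h 1 1 - 1) _ K).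
by apply: filterS hK => h [].
Qed.

Let h_cvg : h @[h --> (0:R)^'+] --> (0 : R).
Proof. by apply: cvg_at_right_filter; exact: cvg_id. Qed.

Let AE h : 0 < h -> [/\ A h 0 0 = 1 + h * al h, A h 0 1 = h * be h,
  A h 1 0 = h * ga h & A h 1 1 = 1 + h * de h].
Proof.
move=> h0; have hn : h != 0 by rewrite gt_eqF.
by rewrite /al /be /ga /de; split; field.
Qed.

(** After division by the right power of [h], the four quantities tend to
    [nu ^+ 2 - 4], [nu], [1] and [4]; the first limit is where [nu != 2] is
    used. *)
Lemma scheme_nondegenerate : \forall h \near 0^'+,
  [/\ (A h 0 0 + A h 1 1) ^+ 2
        - 4 * (A h 0 0 * A h 1 1 - A h 0 1 * A h 1 0) != 0,
      1 - (A h 0 0 * A h 1 1 - A h 0 1 * A h 1 0) != 0,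
      1 - (A h 0 0 + A h 1 1) + (A h 0 0 * A h 1 1 - A h 0 1 * A h 1 0) != 0 &
      1 + (A h 0 0 + A h 1 1) + (A h 0 0 * A h 1 1 - A h 0 1 * A h 1 0) != 0].
Proof.
have disc_cvg : (al h - de h) ^+ 2 + 4 * (be h * ga h) @[h --> 0^'+] -->
    (- nu - 0) ^+ 2 + 4 * (-1 * 1).
  apply: cvgD; first by apply: cvgM; exact: cvgB.
  by apply: cvgM; [exact: cvg_cst|exact: cvgM].
have det_cvg : al h * de h - be h * ga h @[h --> 0^'+] --> - nu * 0 - (-1 * 1).
  by apply: cvgB; exact: cvgM.
have det1_cvg : al h + de h + h * (al h * de h - be h * ga h) @[h --> 0^'+] -->
    (- nu + 0) + 0 * (- nu * 0 - (-1 * 1)).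
  by apply: cvgD; [exact: cvgD|exact: cvgM].
have det4_cvg : 4 + 2 * h * (al h + de h) + h ^+ 2 * (al h * de h - be h * ga h)
    @[h --> 0^'+] --> 4 + 2 * 0 * (- nu + 0) + 0 ^+ 2 * (- nu * 0 - (-1 * 1)).
  apply: cvgD; last by apply: cvgM => //; apply: cvgM.
  apply: cvgD; first exact: cvg_cst.
  apply: cvgM; last exact: cvgD.
  by apply: cvgM => //; exact: cvg_cst.
near=> h.
have h0 : 0 < h by near: h; exact: nbhs_right_gt.
have hn : h != 0 by rewrite gt_eqF.
have [-> -> -> ->] := AE h0; split.
- rewrite [X in X != 0](_ : _ = h ^+ 2 * ((al h - de h) ^+ 2 + 4 * (be h * ga h))); last by ring.
  rewrite mulf_neq0 ?expf_neq0//; near: h.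
  apply: (cvgr_neq0 _ disc_cvg).
  rewrite (_ : _ + _ = (nu - 2) * (nu + 2)); last by ring.
  by rewrite mulf_neq0 ?subr_eq0// gt_eqF// addr_gt0.
- rewrite [X in X != 0](_ : _ = - (h * (al h + de h + h * (al h * de h - be h * ga h)))); last by ring.
  rewrite oppr_eq0 mulf_neq0//; near: h; apply: (cvgr_neq0 _ det1_cvg).
  by rewrite mul0r !addr0 oppr_eq0 gt_eqF.
- rewrite [X in X != 0](_ : _ = h ^+ 2 * (al h * de h - be h * ga h)); last by ring.
  rewrite mulf_neq0 ?expf_neq0//; near: h; apply: (cvgr_neq0 _ det_cvg).
  by rewrite mulr0 sub0r mulr1 opprK oner_neq0.
- rewrite [X in X != 0](_ : _ = 4 + 2 * h * (al h + de h) + h ^+ 2 * (al h * de h - be h * ga h)); last by ring.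
  near: h; apply: (cvgr_neq0 _ det4_cvg).
  by rewrite expr0n /= mulr0 !mul0r !addr0 pnatr_eq0.
Unshelve. all: by end_near. Qed.

(** The energy after one step is [energy + h * form], where the coefficients of
    the quadratic form tend to those of [damped_form_le]. *)
Lemma scheme_contraction : exists2 delta : R, 0 <= delta <= 1 &
  \forall h \near 0^'+, exists2 rho : R, 0 <= rho < 1 & forall p q : R,
    energy delta (A h 0 0 * p + A h 0 1 * q, A h 1 0 * p + A h 1 1 * q)
    <= rho * energy delta (p, q).
Proof.
pose delta := 4 * nu / (4 + nu ^+ 2).
have D0 : 0 < 4 + nu ^+ 2 by rewrite ltr_pwDl ?sqr_ge0.
have delta0 : 0 < delta by rewrite divr_gt0 ?mulr_gt0.
have delta1 : delta <= 1.
  by rewrite ler_pdivrMr// mul1r; have := sqr_ge0 (nu - 2); nra.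
have delta01 : 0 <= delta <= 1 by rewrite ltW.
exists delta => //.
have c11_cvg : 2 * al h + delta * ga h +
    h * (al h ^+ 2 + delta * (al h * ga h) + ga h ^+ 2) @[h --> 0^'+] -->
    2 * (- nu) + delta * 1 + 0 * ((- nu) ^+ 2 + delta * (- nu * 1) + 1 ^+ 2).
  apply: cvgD; first by apply: cvgD; apply: cvgM => //; exact: cvg_cst.
  apply: cvgM => //; apply: cvgD; last exact: cvgM.
  apply: cvgD; first exact: cvgM.
  by apply: cvgM; [exact: cvg_cst|exact: cvgM].
have c12_cvg : 2 * be h + 2 * ga h + delta * (al h + de h) +
    h * (2 * (al h * be h) + delta * (al h * de h + be h * ga h) + 2 * (ga h * de h))
    @[h --> 0^'+] --> 2 * (-1) + 2 * 1 + delta * (- nu + 0) +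
    0 * (2 * (- nu * -1) + delta * (- nu * 0 + -1 * 1) + 2 * (1 * 0)).
  apply: cvgD.
    apply: cvgD; first by apply: cvgD; apply: cvgM => //; exact: cvg_cst.
    by apply: cvgM; [exact: cvg_cst|exact: cvgD].
  apply: cvgM => //; apply: cvgD; last by apply: cvgM; [exact: cvg_cst|exact: cvgM].
  apply: cvgD; first by apply: cvgM; [exact: cvg_cst|exact: cvgM].
  by apply: cvgM; [exact: cvg_cst|apply: cvgD; exact: cvgM].
have c22_cvg : 2 * de h + delta * be h +
    h * (be h ^+ 2 + delta * (be h * de h) + de h ^+ 2) @[h --> 0^'+] -->
    2 * 0 + delta * (-1) + 0 * ((-1) ^+ 2 + delta * (-1 * 0) + 0 ^+ 2).
  apply: cvgD; first by apply: cvgD; apply: cvgM => //; exact: cvg_cst.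
  apply: cvgM => //; apply: cvgD; last exact: cvgM.
  apply: cvgD; first exact: cvgM.
  by apply: cvgM; [exact: cvg_cst|exact: cvgM].
have e8 : 0 < delta / 8 by rewrite divr_gt0.
have n11 := near_dist_le e8 c11_cvg; have n12 := near_dist_le e8 c12_cvg.
have n22 := near_dist_le e8 c22_cvg.
near=> h.
have h0 : 0 < h by near: h; exact: nbhs_right_gt.
have h1 : h <= 1 by near: h; exact: nbhs_right_le.
exists (1 - h * (delta / 8)).
  apply/andP; split; first by nra.
  by rewrite gtrBl mulr_gt0.
move=> p q; have [-> -> -> ->] := AE h0.
have form := damped_form_le p q nu_gt0 (erefl delta).
have b11 : `|2 * al h + delta * ga h +
    h * (al h ^+ 2 + delta * (al h * ga h) + ga h ^+ 2) - (- 2 * nu + delta)|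
    <= delta / 8.
  by near: h; apply: filterS n11 => h; rewrite mul0r addr0 mulr1 mulrN -mulNr.
have b12 : `|2 * be h + 2 * ga h + delta * (al h + de h) +
    h * (2 * (al h * be h) + delta * (al h * de h + be h * ga h) + 2 * (ga h * de h))
    - (- (delta * nu))| <= delta / 8.
  near: h; apply: filterS n12 => h.
  by rewrite mul0r !addr0 mulr1 mulrN1 addNr add0r (mulrN delta nu).
have b22 : `|2 * de h + delta * be h +
    h * (be h ^+ 2 + delta * (be h * de h) + de h ^+ 2) - (- delta)| <= delta / 8.
  by near: h; apply: filterS n22 => h; rewrite mul0r addr0 mulr0 add0r mulrN1.
have bound := quadratic_form_le b11 b12 b22 form.
have /andP[_ up] := energy_bounds (p, q) delta01.
have := ler_wpM2l (ltW h0) bound => hb.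
have hup : h * (delta / 8) * energy delta (p, q) <=
    h * (delta / 8) * (2 * (p ^+ 2 + q ^+ 2)).
  by rewrite ler_wpM2l// mulr_ge0 ?ltW.
rewrite (_ : energy delta _ = energy delta (p, q) + h *
    ((2 * al h + delta * ga h +
      h * (al h ^+ 2 + delta * (al h * ga h) + ga h ^+ 2)) * p ^+ 2 +
     (2 * be h + 2 * ga h + delta * (al h + de h) +
      h * (2 * (al h * be h) + delta * (al h * de h + be h * ga h)
           + 2 * (ga h * de h))) * (p * q) +
     (2 * de h + delta * be h +
      h * (be h ^+ 2 + delta * (be h * de h) + de h ^+ 2)) * q ^+ 2)); last first.
  by rewrite /energy /=; ring.
rewrite mulrBl mul1r lerD2l; apply: (le_trans hb).
rewrite lerNr; apply: (le_trans hup).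
by rewrite le_eqVlt; apply/orP; left; apply/eqP; rewrite /=; field.
Unshelve. all: by end_near. Qed.

End scheme.
End energy.

(** * The covariance formula as a Lyapunov equation *)

Section covariance_formula.
Context {C : numClosedFieldType}.
Variables (M : 'M[C]_2) (b : 'cV[C]_2) (eps h : C).
Set Implicit Arguments.
Unset Strict Implicit.

Let trE : \tr M = M 0 0 + M 1 1.
Proof.
by rewrite /mxtrace !big_ord_recl big_ord0 addr0; congr (_ + M _ _); apply/val_inj.
Qed.

Let detE : \det M = M 0 0 * M 1 1 - M 0 1 * M 1 0.
Proof.
have i1 (k : 'I_1) : lift ord0 k = 1 :> 'I_2 by apply/val_inj; rewrite (ord1 k).
have i0 (k : 'I_1) : lift 1 k = 0 :> 'I_2 by apply/val_inj; rewrite (ord1 k).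
rewrite (expand_det_row _ ord0) !big_ord_recl big_ord0 /cofactor !det_mx11.
by rewrite !mxE !i1 !i0 expr0 expr1 mul1r mulN1r mulrN addr0.
Qed.

Lemma lambda_sum : lambda1 M + lambda2 M = M 0 0 + M 1 1.
Proof. by rewrite -trE /lambda1 /lambda2; field. Qed.

Lemma lambda_prod : lambda1 M * lambda2 M = M 0 0 * M 1 1 - M 0 1 * M 1 0.
Proof.
rewrite -detE /lambda1 /lambda2; set s := sqrtC _.
rewrite (_ : _ * _ = (\tr M ^+ 2 - s ^+ 2) / 4); last by field.
by rewrite sqrtCK; field.
Qed.

(** [(l2 - l1) ^+ 2] is the discriminant, [(1 - l1 ^+ 2) * (1 - l2 ^+ 2)] the
    product of the values of the characteristic polynomial at 1 and -1, and
    [l1 * l2] the determinant. *)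
Lemma sigma_definedP :
  (M 0 0 + M 1 1) ^+ 2 - 4 * (M 0 0 * M 1 1 - M 0 1 * M 1 0) != 0 ->
  1 - (M 0 0 * M 1 1 - M 0 1 * M 1 0) != 0 ->
  1 - (M 0 0 + M 1 1) + (M 0 0 * M 1 1 - M 0 1 * M 1 0) != 0 ->
  1 + (M 0 0 + M 1 1) + (M 0 0 * M 1 1 - M 0 1 * M 1 0) != 0 ->
  sigma_defined M.
Proof.
have := lambda_sum; have := lambda_prod.
set l1 := lambda1 M; set l2 := lambda2 M => <- <- d1 d2 d3 d4.
have f3 : (1 - l1) * (1 - l2) != 0.
  by rewrite (_ : _ * _ = 1 - (l1 + l2) + l1 * l2)//; ring.
have f4 : (1 + l1) * (1 + l2) != 0.
  by rewrite (_ : _ * _ = 1 + (l1 + l2) + l1 * l2)//; ring.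
move: f3 f4; rewrite !mulf_eq0 !negb_or => /andP[n1 n2] /andP[p1 p2].
split => //.
- apply: contra_neq d1 => l21.
  by rewrite (_ : _ - _ = (l2 - l1) ^+ 2); [rewrite l21 expr0n|ring].
- by rewrite -/l1 (_ : _ - _ = (1 - l1) * (1 + l1)); [rewrite mulf_neq0|ring].
- by rewrite -/l2 (_ : _ - _ = (1 - l2) * (1 + l2)); [rewrite mulf_neq0|ring].
Qed.

Let l1 := lambda1 M.
Let l2 := lambda2 M.
(** The vectors [p = (M - l2) b] and [q = (M - l1) b] are eigenvectors for [l1]
    and [l2], and [p - q] is a multiple of [b]. *)
Let p1 := M 0 1 * b 1 0 + b 0 0 * (M 0 0 - l2).
Let p2 := M 1 0 * b 0 0 + b 1 0 * (l1 - M 0 0).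
Let q1 := M 0 1 * b 1 0 + b 0 0 * (M 0 0 - l1).
Let q2 := M 1 0 * b 0 0 + b 1 0 * (l2 - M 0 0).

Let M11 : M 1 1 = l1 + l2 - M 0 0.
Proof. by rewrite lambda_sum; ring. Qed.

(** The Cayley-Hamilton relation, solved for the product of the off-diagonal
    entries. *)
Let rel : M 0 1 * M 1 0 = - ((M 0 0 - l1) * (M 0 0 - l2)).
Proof.
have : l1 * l2 = M 0 0 * (l1 + l2 - M 0 0) - M 0 1 * M 1 0.
  by rewrite -M11 lambda_prod.
by move=> E; rewrite mulrBl !mulrBr E; ring.
Qed.

(** Polynomial identities modulo [rel]; the cofactor [k] is supplied by hand. *)
Let modrel (x y k : C) :
  x - y = k * (M 0 1 * M 1 0 + (M 0 0 - l1) * (M 0 0 - l2)) -> x = y.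
Proof. by rewrite rel addNr mulr0 => /eqP; rewrite subr_eq0 => /eqP. Qed.

(** What is left of [sigma_form] when its prefactor is removed, in terms of the
    eigenvectors. *)
Let sform (u v : C) : C := (u * p1 + v * p2) ^+ 2 / (1 - l1 ^+ 2)
  + (u * q1 + v * q2) ^+ 2 / (1 - l2 ^+ 2)
  - 2 * (u * p1 + v * p2) * (u * q1 + v * q2) / (1 - l1 * l2).

Let sformE u v : u ^+ 2 * sigma11 M b + 2 * u * v * sigma12 M b
  + v ^+ 2 * sigma22 M b = sform u v.
Proof.
have e11 : 2 * M 0 1 * M 1 0 * b 0 0 ^+ 2 - 2 * M 0 1 ^+ 2 * b 1 0 ^+ 2
    + 2 * M 0 1 * b 0 0 * b 1 0 * (M 1 1 - M 0 0) = - (2 * p1 * q1).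
  by apply: (@modrel _ _ (2 * b 0 0 ^+ 2)); rewrite M11 /p1 /q1; ring.
have e22 : 2 * M 0 1 * M 1 0 * b 1 0 ^+ 2 - 2 * M 1 0 ^+ 2 * b 0 0 ^+ 2
    - 2 * M 1 0 * b 0 0 * b 1 0 * (M 1 1 - M 0 0) = - (2 * p2 * q2).
  by apply: (@modrel _ _ (2 * b 1 0 ^+ 2)); rewrite M11 /p2 /q2; ring.
have e12 : M 1 0 * (M 0 0 - l2) * b 0 0 ^+ 2 + M 0 1 * (l1 - M 0 0) * b 1 0 ^+ 2
    + 2 * M 0 1 * M 1 0 * b 0 0 * b 1 0 = p1 * p2.
  by apply: (@modrel _ _ (b 0 0 * b 1 0)); rewrite /p1 /p2; ring.
have e12' : M 1 0 * (M 0 0 - l1) * b 0 0 ^+ 2 + M 0 1 * (l2 - M 0 0) * b 1 0 ^+ 2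
    + 2 * M 0 1 * M 1 0 * b 0 0 * b 1 0 = q1 * q2.
  by apply: (@modrel _ _ (b 0 0 * b 1 0)); rewrite /q1 /q2; ring.
have e12'' : (M 1 1 - M 0 0) * (M 1 0 * b 0 0 ^+ 2 - M 0 1 * b 1 0 ^+ 2
    + b 0 0 * b 1 0 * (M 1 1 - M 0 0)) = - (p1 * q2 + q1 * p2).
  by apply: (@modrel _ _ (2 * (b 0 0 * b 1 0))); rewrite M11 /p1 /p2 /q1 /q2; ring.
rewrite /sigma11 /sigma22 /sigma12 -/l1 -/l2 -/p1 -/p2 -/q1 -/q2.
rewrite e11 e22 e12 e12' e12'' /sform.
move: (1 - l1 ^+ 2)^-1 (1 - l2 ^+ 2)^-1 (1 - l1 * l2)^-1 => x y z.
by ring.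
Qed.

(** The variance of the linear form with coefficients [u] and [v]. *)
Definition sigma_form (u v : C) : C :=
  u ^+ 2 * sigma M b eps h 0 0 + 2 * u * v * sigma M b eps h 0 1
  + v ^+ 2 * sigma M b eps h 1 1.

Lemma sigma_symmetric : sigma M b eps h 1 0 = sigma M b eps h 0 1.
Proof. by rewrite !mxE. Qed.

(** Replacing [u, v] by its image under the transpose multiplies its pairings
    with [p] and [q] by the eigenvalues, which cancels the denominators and
    leaves the square of the pairing with [p - q]. *)
Lemma sigma_form_lyapunov u v : sigma_defined M ->
  sigma_form u v =
  sigma_form (M 0 0 * u + M 1 0 * v) (M 0 1 * u + M 1 1 * v)
  + eps * h * (u * b 0 0 + v * b 1 0) ^+ 2.
Proof.
move=> [d0 d1 d2 d3]; pose c := eps * h / (l2 - l1) ^+ 2.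
have formE x y : sigma_form x y = c * sform x y.
  by rewrite -sformE /sigma_form !mxE /= -/c; ring.
have eigp : M 0 0 * p1 + M 0 1 * p2 = l1 * p1 /\ M 1 0 * p1 + M 1 1 * p2 = l1 * p2.
  split; first by apply: (@modrel _ _ (b 0 0)); rewrite /p1 /p2; ring.
  by apply: (@modrel _ _ (b 1 0)); rewrite M11 /p1 /p2; ring.
have eigq : M 0 0 * q1 + M 0 1 * q2 = l2 * q1 /\ M 1 0 * q1 + M 1 1 * q2 = l2 * q2.
  split; first by apply: (@modrel _ _ (b 0 0)); rewrite /q1 /q2; ring.
  by apply: (@modrel _ _ (b 1 0)); rewrite M11 /q1 /q2; ring.
have dualp : (M 0 0 * u + M 1 0 * v) * p1 + (M 0 1 * u + M 1 1 * v) * p2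
    = l1 * (u * p1 + v * p2).
  rewrite (_ : l1 * _ = u * (l1 * p1) + v * (l1 * p2)); last by ring.
  by rewrite -(proj1 eigp) -(proj2 eigp); ring.
have dualq : (M 0 0 * u + M 1 0 * v) * q1 + (M 0 1 * u + M 1 1 * v) * q2
    = l2 * (u * q1 + v * q2).
  rewrite (_ : l2 * _ = u * (l2 * q1) + v * (l2 * q2)); last by ring.
  by rewrite -(proj1 eigq) -(proj2 eigq); ring.
have wb : (u * p1 + v * p2) - (u * q1 + v * q2) = (l1 - l2) * (u * b 0 0 + v * b 1 0).
  by rewrite /p1 /p2 /q1 /q2; ring.
rewrite !formE /sform dualp dualq.
have -> : eps * h * (u * b 0 0 + v * b 1 0) ^+ 2 =
    c * ((u * p1 + v * p2) - (u * q1 + v * q2)) ^+ 2.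
  by rewrite wb /c; field.
by move: (u * p1 + v * p2) (u * q1 + v * q2) => x y; field; rewrite d1 d2 d3.
Qed.

End covariance_formula.

(** * Solving the Lyapunov equation by iteration *)

Section lyapunov.
Context {R : realType}.
Variable A : 'M[R]_2.
Set Implicit Arguments.
Unset Strict Implicit.

Lemma iter_act_decay (delta rho : R) : 0 <= delta <= 1 -> 0 <= rho ->
  (forall p q, energy delta (A 0 0 * p + A 0 1 * q, A 1 0 * p + A 1 1 * q)
    <= rho * energy delta (p, q)) ->
  forall x n, `|(iter n (act A) x).1| <= Num.sqrt (2 * energy delta x) * Num.sqrt rho ^+ n /\
              `|(iter n (act A) x).2| <= Num.sqrt (2 * energy delta x) * Num.sqrt rho ^+ n.
Proof.
move=> delta01 rho0 contr x n.
have E0 y : 0 <= energy delta y.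
  have /andP[lo _] := energy_bounds y delta01; apply: le_trans lo.
  by rewrite divr_ge0// addr_ge0 ?sqr_ge0.
have En : energy delta (iter n (act A) x) <= rho ^+ n * energy delta x.
  elim: n => [|n IH]; first by rewrite expr0 mul1r.
  rewrite exprS -mulrA; apply: (@le_trans _ _ (rho * energy delta (iter n (act A) x))).
    by rewrite iterS; case: (iter n (act A) x) => p q; exact: contr.
  by rewrite ler_wpM2l.
have /andP[lo _] := energy_bounds (iter n (act A) x) delta01.
have N : (iter n (act A) x).1 ^+ 2 + (iter n (act A) x).2 ^+ 2
    <= 2 * energy delta x * rho ^+ n.
  rewrite (_ : 2 * _ * _ = rho ^+ n * energy delta x * 2); last by ring.
  by move: lo; rewrite ler_pdivrMr// => lo; rewrite (le_trans lo)// ler_wpM2r.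
have -> : Num.sqrt (2 * energy delta x) * Num.sqrt rho ^+ n =
    Num.sqrt (2 * energy delta x * rho ^+ n).
  rewrite [in RHS]sqrtrM ?mulr_ge0//; congr (_ * _); elim: n {En lo N} => [|n IH].
    by rewrite !expr0 sqrtr1.
  by rewrite !exprS IH sqrtrM.
split; rewrite -sqrtr_sqr ler_wsqrtr//; apply: le_trans N.
  by rewrite lerDl sqr_ge0.
by rewrite lerDr sqr_ge0.
Qed.

(** Geometric decay of the iterates, with a ratio that does not depend on the
    starting point. *)
Definition decaying := exists2 r : R, 0 <= r < 1 & forall x, exists2 C : R, 0 <= C &
  forall n, `|(iter n (act A) x).1| <= C * r ^+ n /\ `|(iter n (act A) x).2| <= C * r ^+ n.

Lemma decaying_of_contraction (delta rho : R) : 0 <= delta <= 1 -> 0 <= rho < 1 ->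
  (forall p q, energy delta (A 0 0 * p + A 0 1 * q, A 1 0 * p + A 1 1 * q)
    <= rho * energy delta (p, q)) -> decaying.
Proof.
move=> delta01 /andP[rho0 rho1] contr; exists (Num.sqrt rho).
  by rewrite sqrtr_ge0 /= -sqrtr1 ltr_sqrt.
move=> x; exists (Num.sqrt (2 * energy delta x)); first exact: sqrtr_ge0.
exact: (iter_act_decay delta01 rho0 contr x).
Qed.

Hypothesis dec : decaying.

Lemma iter_act_cvg0 x : iter n (act A) x @[n --> \oo] --> (0 : R * R).
Proof.
have [r /andP[r0 r1] /(_ x) [C C0 bound]] := dec.
have geo : C * r ^+ n @[n --> \oo] --> (0 : R).
  rewrite -[X in _ --> X](mulr0 C); apply: cvgM; first exact: cvg_cst.
  by apply: cvg_expr; rewrite ger0_norm.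
have geoN : - (C * r ^+ n) @[n --> \oo] --> (0 : R).
  by rewrite -[X in _ --> X]oppr0; exact: cvgN.
have c1 : (iter n (act A) x).1 @[n --> \oo] --> (0 : R).
  apply: (squeeze_cvgr _ geoN geo); apply: nearW => n.
  by rewrite -ler_norml; have [] := bound n.
have c2 : (iter n (act A) x).2 @[n --> \oo] --> (0 : R).
  apply: (squeeze_cvgr _ geoN geo); apply: nearW => n.
  by rewrite -ler_norml; have [] := bound n.
rewrite (_ : (fun n => _) = (fun n => ((iter n (act A) x).1, (iter n (act A) x).2))).
  exact: (cvg_pair c1 c2).
by apply/funext => n; case: (iter n (act A) x).
Qed.

(** Iterate the equation: the quadratic form evaluated at the iterates of the
    transpose tends to 0, and the inhomogeneous terms add up to the series. *)
Lemma lyapunov_series (s t z kappa : R) (v0 : R * R) :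
  let q (u v : R) := u ^+ 2 * s + 2 * u * v * t + v ^+ 2 * z in
  (forall u v, q u v = q (A 0 0 * u + A 1 0 * v) (A 0 1 * u + A 1 1 * v)
     + kappa * (u * v0.1 + v * v0.2) ^+ 2) ->
  forall u v, kappa * (\sum_(k < n) (u * (response A v0 k).1
     + v * (response A v0 k).2) ^+ 2) @[n --> \oo] --> q u v.
Proof.
move=> q qE u v.
pose e1 : R * R := (1, 0); pose e2 : R * R := (0, 1).
(* pairing of [(u, v)] with the iterates of [x]: the coordinates of the iterated
   transpose are its values at the basis vectors *)
pose dual (x : R * R) n : R := u * (iter n (act A) x).1 + v * (iter n (act A) x).2.
have actE x : act A x = x.1 *: act A e1 + x.2 *: act A e2.
  by case: x => x y; rewrite /act /e1 /e2; congr pair; rewrite /= /GRing.scale/=; ring.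
have xE (x : R * R) : x = x.1 *: e1 + x.2 *: e2.
  by case: x => x y; congr pair; rewrite /= /GRing.scale/=; ring.
have dualE x n : dual x n = x.1 * dual e1 n + x.2 * dual e2 n.
  rewrite {1}/dual {1 2}(xE x) iter_actD !iter_actZ /dual /= /GRing.scale /=.
  by ring.
have dualS x n : dual x n.+1 = dual (act A x) n by rewrite /dual iterSr.
have telescope n : q u v = q (dual e1 n) (dual e2 n) +
    kappa * (\sum_(k < n) (u * (response A v0 k).1 + v * (response A v0 k).2) ^+ 2).
  elim: n => [|n IH].
    by rewrite big_ord0 mulr0 addr0 /dual /= !mulr0 !mulr1 addr0 add0r.
  rewrite IH big_ord_recr /= mulrDr addrA addrAC; congr (_ + _).
  rewrite qE !dualS (dualE (act A e1)) (dualE (act A e2)); congr (_ + _).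
    by congr q; rewrite /act /e1 /e2 /=; ring.
  congr (_ * _ ^+ 2).
  by rewrite -[RHS]/(dual v0 n) (dualE v0); ring.
have dual0 x : dual x n @[n --> \oo] --> (0 : R).
  have c := iter_act_cvg0 x.
  have c1 : (iter n (act A) x).1 @[n --> \oo] --> (0 : R) by exact: (cvg_comp _ _ c cvg_fst).
  have c2 : (iter n (act A) x).2 @[n --> \oo] --> (0 : R) by exact: (cvg_comp _ _ c cvg_snd).
  have := cvgD (cvgM (cvg_cst u) c1) (cvgM (cvg_cst v) c2).
  by rewrite !mulr0 addr0; exact.
have rest : q (dual e1 n) (dual e2 n) @[n --> \oo] --> (0 : R).
  have d1 := dual0 e1; have d2 := dual0 e2.
  have := cvgD (cvgD (cvgM (cvgM d1 d1) (cvg_cst s))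
    (cvgM (cvgM (cvgM (cvg_cst (2 : R)) d1) d2) (cvg_cst t)))
    (cvgM (cvgM d2 d2) (cvg_cst z)).
  by rewrite !(mulr0, mul0r) !addr0; exact.
rewrite (_ : (fun n => _) = (fun n => q u v - q (dual e1 n) (dual e2 n))).
  by rewrite -[X in _ --> X]subr0; apply: cvgB => //; exact: cvg_cst.
by apply/funext => n; rewrite [in RHS](telescope n) addrAC subrr add0r.
Qed.

(** The eigenvalues may be complex. The real part of the covariance formula
    solves the real Lyapunov equation, and its imaginary part the homogeneous
    one, whose only solution is 0. *)
Lemma sigma_real (b : 'cV[R]_2) (eps h : R) :
  sigma_defined (map_mx (real_complex R) A) ->
  exists S : 'M[R]_2,
    [/\ map_mx (real_complex R) S = sigma (map_mx (real_complex R) A)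
          (map_mx (real_complex R) b) eps%:C h%:C,
        S 0 1 = S 1 0 &
        let q (u v : R) := u ^+ 2 * S 0 0 + 2 * u * v * S 0 1 + v ^+ 2 * S 1 1 in
        forall u v, q u v = q (A 0 0 * u + A 1 0 * v) (A 0 1 * u + A 1 1 * v)
          + eps * h * (u * b 0 0 + v * b 1 0) ^+ 2].
Proof.
set AC := map_mx _ A; set bC := map_mx _ b => def.
set Sig := sigma AC bC eps%:C h%:C.
have lyap (u v : R) := sigma_form_lyapunov bC eps%:C h%:C u%:C v%:C def.
have ReZ (x : R) (y : R[i]) : complex.Re (x%:C * y) = x * complex.Re y.
  by case: y => y1 y2 /=; rewrite mul0r subr0.
have ImZ (x : R) (y : R[i]) : complex.Im (x%:C * y) = x * complex.Im y.
  by case: y => y1 y2 /=; rewrite mul0r addr0.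
pose form (f : R[i] -> R) (u v : R) := u ^+ 2 * f (Sig 0 0)
  + 2 * u * v * f (Sig 0 1) + v ^+ 2 * f (Sig 1 1).
have sigE (u v : R) : sigma_form AC bC eps%:C h%:C u%:C v%:C =
    (u ^+ 2)%:C * Sig 0 0 + (2 * u * v)%:C * Sig 0 1 + (v ^+ 2)%:C * Sig 1 1.
  by rewrite /sigma_form -/Sig !rmorphXn /= !rmorphM /= rmorph_nat.
have lyapC (u v : R) : sigma_form AC bC eps%:C h%:C u%:C v%:C =
    sigma_form AC bC eps%:C h%:C (A 0 0 * u + A 1 0 * v)%:C (A 0 1 * u + A 1 1 * v)%:C
    + (eps * h * (u * b 0 0 + v * b 1 0) ^+ 2)%:C.
  by rewrite lyap !mxE !(rmorphD, rmorphXn, rmorphM).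
have lyapRe u v : form (@complex.Re R) u v =
    form (@complex.Re R) (A 0 0 * u + A 1 0 * v) (A 0 1 * u + A 1 1 * v)
    + eps * h * (u * b 0 0 + v * b 1 0) ^+ 2.
  by have := congr1 (@complex.Re R) (lyapC u v); rewrite !sigE !raddfD /= !ReZ.
have lyapIm u v : form (@complex.Im R) u v =
    form (@complex.Im R) (A 0 0 * u + A 1 0 * v) (A 0 1 * u + A 1 1 * v)
    + 0 * (u * 0 + v * 0) ^+ 2.
  rewrite mul0r addr0.
  by have := congr1 (@complex.Im R) (lyapC u v); rewrite !sigE !raddfD /= !ImZ addr0.
have formIm u v : form (@complex.Im R) u v = 0.
  have := @lyapunov_series (complex.Im (Sig 0 0)) (complex.Im (Sig 0 1))
    (complex.Im (Sig 1 1)) 0 (0, 0) lyapIm u v.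
  under eq_fun do rewrite mul0r.
  by move/cvg_unique => /(_ _ _ (cvg_cst 0)); apply.
have Im00 : complex.Im (Sig 0 0) = 0.
  rewrite -(formIm 1 0) /form; ring.
have Im11 : complex.Im (Sig 1 1) = 0.
  rewrite -(formIm 0 1) /form; ring.
have Im01 : complex.Im (Sig 0 1) = 0.
  have := formIm 1 1; rewrite /form Im00 Im11 !mulr0 add0r addr0 => /eqP.
  by rewrite !mulr1 mulf_eq0 pnatr_eq0 /= => /eqP.
have Sig10 : Sig 1 0 = Sig 0 1 by rewrite /Sig sigma_symmetric.
have real (z : R[i]) : complex.Im z = 0 -> (complex.Re z)%:C = z.
  by case: z => x y /= ->.
exists (\matrix_(i, j) complex.Re (Sig i j)); split.
- apply/matrixP => i j; rewrite [LHS]mxE [in LHS]mxE; apply: real.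
  have ord2 (k : 'I_2) : k = 0 \/ k = 1.
    by case: k => -[|[|//]] kk; [left|right]; apply/val_inj.
  by case: (ord2 i) => ->; case: (ord2 j) => ->//; rewrite Sig10.
- by rewrite [LHS]mxE [RHS]mxE Sig10.
- move=> q u v; rewrite /q; have := lyapRe u v; rewrite /form.
  have E i j : (\matrix_(i, j) complex.Re (Sig i j)) i j = complex.Re (Sig i j).
    by rewrite mxE.
  by rewrite !E.
Qed.

End lyapunov.

(** * The stationary law of the scheme *)

Section stationary_law.
Context {R : realType} d (T : measurableType d) (P : probability T R).
Set Implicit Arguments.
Unset Strict Implicit.

Lemma partial_noise_ae_cvg (A : 'M[R]_2) (v0 : R * R) (xi : nat -> T -> R) (m1 : R) :
  decaying A -> (forall k, measurable_fun setT (xi k)) ->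
  (forall k, \int[P]_w `|xi k w|%:E = m1%:E)%E ->
  exists2 Yoo : T -> R * R, measurable_fun setT Yoo &
    {ae P, forall w, partial_noise A v0 xi n w @[n --> \oo] --> Yoo w}.
Proof.
move=> [r /andP[r0 r1] /(_ v0) [C C0 bound]] mxi xi1.
have m10 : 0 <= m1.
  by rewrite -lee_fin -(xi1 0%N); apply: integral_ge0 => w _; rewrite lee_fin.
have coord (c : nat -> R) : (forall k, `|c k| <= C * r ^+ k) ->
    exists2 Z : T -> R, measurable_fun setT Z &
    {ae P, forall w, \sum_(k < n) xi k w * c k @[n --> \oo] --> Z w}.
  move=> cC; have mx k : measurable_fun setT (fun w => xi k w * c k).
    exact: measurable_funM.
  apply: (ae_cvg_series (C := C * m1) mx _ r0 r1) => [|k]; first exact: mulr_ge0.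
  under eq_integral do rewrite normrM mulrC EFinM.
  rewrite ge0_integralZl//; last first.
    by apply/measurable_EFinP; exact: measurableT_comp.
  rewrite xi1 -EFinM lee_fin mulrAC.
  by rewrite ler_wpM2r.
have [Z1 mZ1 c1] := coord (fun k => (response A v0 k).1) (fun k => proj1 (bound k)).
have [Z2 mZ2 c2] := coord (fun k => (response A v0 k).2) (fun k => proj2 (bound k)).
exists (fun w => (Z1 w, Z2 w)); first exact: measurable_fun_pair.
apply: filterS2 c1 c2 => w w1 w2.
rewrite (_ : (fun n => _) = (fun n => (\sum_(k < n) xi k w * (response A v0 k).1,
    \sum_(k < n) xi k w * (response A v0 k).2))); first exact: (cvg_pair w1 w2).
apply/funext; elim => [|n IH]; rewrite /partial_noise ?big_ord0// !big_ord_recr /=.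
by rewrite -/(partial_noise A v0 xi n w) IH.
Qed.

End stationary_law.

Section method.
Context {R : realType} d (T : measurableType d) (P : probability T R)
  (W : R -> {RV P >-> R}).
Set Implicit Arguments.
Unset Strict Implicit.

Lemma method_chain (A : 'M[R]_2) (b : 'cV[R]_2) (eps h : R) x n w :
  Defs.method W A b eps h x n w =
  chain A (Num.sqrt eps * b 0 0, Num.sqrt eps * b 1 0) x
    (fun k => incr W (fun k => k%:R * h) k w) n.
Proof.
rewrite /method; elim: n => [|n IH].
  by case: x => p q; rewrite /pair_of_col !mxE.
rewrite [RHS]/= -IH /pair_of_col /act /= !mxE !big_ord_recl !big_ord0 /= !addr0.
have -> : lift ord0 ord0 = 1 :> 'I_2 by apply/val_inj.
by congr pair; rewrite /= /GRing.scale /= /incr; ring.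
Qed.

Hypothesis hW : standard_wiener W.
Variable h : R.
Hypothesis h0 : 0 < h.

Let xi := incr W (fun k => k%:R * h).

Let t_ge0 k : 0 <= k%:R * h. Proof. by rewrite mulr_ge0// ltW. Qed.

Let t_nd k : k%:R * h <= k.+1%:R * h. Proof. by apply: ler_wpM2r; [exact: ltW|rewrite ler_nat]. Qed.

Let xi_std k : same_law P (xi k) std_normal ( *%R (Num.sqrt h)).
Proof.
have := incr_law hW (t := fun k => k%:R * h) (k := k) (t_ge0 k) (t_nd k).
by rewrite -mulrBl -natrB// subSnn mul1r.
Qed.

(** The invariant measure is the law of the noise series. Uniqueness: a law that
    does not move under the chain must equal its limit. The projections of the
    series are limits of normal variables, with the variance given by
    [lyapunov_series]. *)
Lemma scheme_stationary_law (A : 'M[R]_2) (b : 'cV[R]_2) (eps : R) : 0 < eps ->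
  decaying A -> sigma_defined (map_mx (real_complex R) A) ->
  exists mu : probability (R * R)%type R,
    [/\ invariant_measure P (Defs.method W A b eps h) mu,
        (forall mu' : probability (R * R)%type R,
           invariant_measure P (Defs.method W A b eps h) mu' ->
           forall B : set (R * R), measurable B -> mu' B = mu B) &
        exists S : 'M[R]_2,
          map_mx (real_complex R) S = sigma (map_mx (real_complex R) A)
            (map_mx (real_complex R) b) eps%:C h%:C /\
          centered_gaussian2 S mu].
Proof.
move=> eps0 dec def.
pose v0 := (Num.sqrt eps * b 0 0, Num.sqrt eps * b 1 0).
have mxi k : measurable_fun setT (xi k) by exact: measurable_incr.
have ms : measurable_fun setT ( *%R (Num.sqrt h) : R -> R) by exact: mulrl_measurable.
have xi_law k : same_law P (xi k) P (xi 0%N).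
  by move=> B mB; rewrite (xi_std k mB) (xi_std 0 mB).
have xi_ind n : independent_seq P xi n.
  exact: (incr_independent hW n (t_ge0 0%N) t_nd).
have [m1 xi1] : exists m1 : R, forall k, (\int[P]_w `|xi k w|%:E = m1%:E)%E.
  have iN : std_normal.-integrable setT (fun x : R => `|Num.sqrt h * x|%:E).
    have i1 : std_normal.-integrable setT (fun x : R => (Num.sqrt h * x)%:E).
      under eq_fun do rewrite EFinM.
      by apply: integrableZl => //; exact: integrable_std_normal.
    exact: (integrable_norm i1).
  exists (fine (\int[std_normal]_x `|Num.sqrt h * x|%:E)%E) => k.
  rewrite fineK; last exact: (integrable_fin_num measurableT iN).
  have mnorm : measurable_fun setT (Num.norm : R -> R) by exact: normr_measurable.
  by have [] := same_law_integrable (mxi k) ms (xi_std k) mnorm iN.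
have [Yoo mYoo cYoo] := partial_noise_ae_cvg v0 dec mxi xi1.
pose Y : {mfun T >-> (R * R)%type} := HB.pack Yoo
  (isMeasurableFun.Build _ _ _ _ _ mYoo).
pose mu : probability (R * R)%type R := distribution P Y.
have muE B : mu B = P (Yoo @^-1` B) by [].
have EE (m : probability (R * R)%type R) (phi : R * R -> R) n :
    (\int[m]_x 'E_P[fun w => phi (Defs.method W A b eps h x n w)] =
     \int[m]_x \int[P]_w (phi (chain A v0 x (xi ^~ w) n))%:E)%E.
  apply: eq_integral => x _; rewrite unlock; apply: eq_integral => w _.
  by rewrite method_chain.
have mu_int (phi : R * R -> R) M : continuous phi -> (forall x, `|phi x| <= M) ->
    (\int[mu]_x (phi x)%:E = \int[P]_w (phi (Yoo w))%:E)%E.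
  move=> cphi phiM.
  have mphi := continuous_measurable_plane cphi.
  have mu_law : same_law mu id P Yoo by [].
  exact: (same_law_integral (@measurable_id _ _ setT) mYoo mu_law mphi phiM).
have bound (phi : R * R -> R) : bounded_fun phi -> exists M, forall x, `|phi x| <= M.
  by move=> [M0 [_ hM]]; exists (M0 + 1) => x; apply: (hM (M0 + 1)); rewrite ?ltrDl.
exists mu; split.
- move=> phi cphi /bound[M phiM] n; rewrite EE (mu_int _ _ cphi phiM).
  exact: (stationary_chain mxi xi_law xi_ind mYoo cYoo).
- move=> mu' inv; apply: probability_eq_on_continuous => phi M cphi phiM.
  have lim := chain_cvg mxi xi_law xi_ind mYoo cYoo (iter_act_cvg0 dec) mu' cphi phiM.
  rewrite (mu_int _ _ cphi phiM); apply: (cvg_unique _ _ lim) => //.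
  rewrite (_ : (fun n => _) = cst (\int[mu']_x (phi x)%:E)%E); first exact: cvg_cst.
  apply/funext => n; rewrite -EE; apply: inv => //.
  by exists M; split; [exact: num_real|move=> y My x _ /=; rewrite (le_trans (phiM x))// ltW].
have [S [SE Ssym lyap]] := sigma_real dec b eps h def.
exists S; split => //.
pose q (u v : R) := u ^+ 2 * S 0 0 + 2 * u * v * S 0 1 + v ^+ 2 * S 1 1.
have series : forall u v, h * (\sum_(k < n) (u * (response A v0 k).1
     + v * (response A v0 k).2) ^+ 2) @[n --> \oo] --> q u v.
  apply: (lyapunov_series dec) => u v; rewrite lyap; congr (_ + _).
  rewrite /v0 /= [in RHS](_ : u * _ + v * _ = Num.sqrt eps * (u * b 0 0 + v * b 1 0)); last by ring.
  by rewrite [in RHS]exprMn sqr_sqrtr; [ring|exact: ltW].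
have sum_ge0 u v n : 0 <= h * (\sum_(k < n) (u * (response A v0 k).1
     + v * (response A v0 k).2) ^+ 2).
  by apply: mulr_ge0; [exact: ltW|apply: sumr_ge0 => k _; exact: sqr_ge0].
apply: centered_gaussian2_of_projections => // u v.
  rewrite -[leRHS](cvg_lim _ (series u v))//.
  by apply: limr_ge; [exact: cvgP (series u v)|exact: nearW].
have mlin : measurable_fun setT (fun x : R * R => u * x.1 + v * x.2).
  apply: measurable_funD.
    by apply: measurable_funM => //; exact: measurable_fst.
  by apply: measurable_funM => //; exact: measurable_snd.
pose c k := u * (response A v0 k).1 + v * (response A v0 k).2.
suff : same_law P (fun w => u * (Yoo w).1 + v * (Yoo w).2) std_normal ( *%R (Num.sqrt (q u v))).
  by [].
have mZ n : measurable_fun setT (fun w => \sum_(k < n) c k * xi k w).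
  by apply: measurable_sum => k; exact: measurable_funM.
apply: (normal_law_limit (Z := fun n w => \sum_(k < n) c k * xi k w)
   (s := fun n => Num.sqrt (h * \sum_(k < n) c k ^+ 2)) mZ) => //.
- exact: (measurableT_comp mlin mYoo).
- apply: filterS cYoo => w cw.
  have ZE n : \sum_(k < n) c k * xi k w =
      u * (partial_noise A v0 xi n w).1 + v * (partial_noise A v0 xi n w).2.
    elim: n => [|n IH]; rewrite /partial_noise ?big_ord0 ?mulr0 ?addr0//.
    rewrite !big_ord_recr /= IH -/(partial_noise A v0 xi n w) /c.
    by rewrite /GRing.scale /=; ring.
  under eq_fun do rewrite ZE.
  exact: (cvgD (cvgM (cvg_cst u) (cvg_comp _ _ cw cvg_fst))
               (cvgM (cvg_cst v) (cvg_comp _ _ cw cvg_snd))).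
- by move=> n; exact: (sum_incr_law hW c n (ltW h0)).
- exact: (cvg_comp _ _ (series u v) (@sqrt_continuous R (q u v))).
Qed.

End method.

Theorem theorem4p3 (R : realType) (d : measure_display) (T : measurableType d)
  (P : probability T R) (W : R -> {RV P >-> R}) (hW : standard_wiener W)
  (nu : R) (nu_gt0 : 0 < nu) (nu_neq2 : nu != 2)
  (A : R -> 'M[R]_2) (b : R -> 'cV[R]_2)
  (hA : (fun h : R => `|A h 0 0 - 1 + nu * h| + `|A h 0 1 + h|
                      + `|A h 1 0 - h| + `|A h 1 1 - 1|)
        =O_ (0^'+) (fun h : R => h ^+ 2))
  (hb : (fun h : R => `|b h 0 0 - 1| + `|b h 1 0|) =O_ (0^'+) (fun h : R => h)) :
  \forall h \near 0^'+, forall eps : R, 0 < eps ->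
    let X := method W (A h) (b h) eps h in
    let AC : 'M[R[i]]_2 := map_mx (real_complex R) (A h) in
    let bC : 'cV[R[i]]_2 := map_mx (real_complex R) (b h) in
    sigma_defined AC /\
    exists mu : probability (R * R)%type R,
      [/\ invariant_measure P X mu,
          (forall mu' : probability (R * R)%type R,
             invariant_measure P X mu' ->
             forall B : set (R * R), measurable B -> mu' B = mu B) &
          exists S : 'M[R]_2,
            map_mx (real_complex R) S = sigma AC bC eps%:C h%:C /\
            centered_gaussian2 S mu].
Proof.
have [delta delta01 contr] := scheme_contraction nu_gt0 hA.
have nondeg := scheme_nondegenerate nu_gt0 nu_neq2 hA.
near=> h.
have h0 : 0 < h by near: h; exact: nbhs_right_gt.
have [n1 n2 n3 n4] : [/\ (A h 0 0 + A h 1 1) ^+ 2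
      - 4 * (A h 0 0 * A h 1 1 - A h 0 1 * A h 1 0) != 0,
    1 - (A h 0 0 * A h 1 1 - A h 0 1 * A h 1 0) != 0,
    1 - (A h 0 0 + A h 1 1) + (A h 0 0 * A h 1 1 - A h 0 1 * A h 1 0) != 0 &
    1 + (A h 0 0 + A h 1 1) + (A h 0 0 * A h 1 1 - A h 0 1 * A h 1 0) != 0].
  by near: h.
have [rho rho01 contr_h] : exists2 rho : R, 0 <= rho < 1 & forall p q : R,
    energy delta (A h 0 0 * p + A h 0 1 * q, A h 1 0 * p + A h 1 1 * q)
    <= rho * energy delta (p, q) by near: h.
move=> eps eps0; set AC := map_mx _ (A h).
have real_neq0 (x : R) : x != 0 -> x%:C != 0 by rewrite fmorph_eq0.
have def : sigma_defined AC.
  apply: sigma_definedP; rewrite !mxE -!rmorphM -rmorphB -?rmorphD.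
  - rewrite (_ : 4 = (4 : R)%:C) -?rmorphXn -?rmorphM -?rmorphB ?rmorph_nat//.
    exact: real_neq0.
  - by rewrite (_ : 1 = (1 : R)%:C)// -rmorphB; exact: real_neq0.
  - by rewrite (_ : 1 = (1 : R)%:C)// -rmorphB -rmorphD; exact: real_neq0.
  - exact: real_neq0.
split => //.
exact: (scheme_stationary_law hW h0 (b h) eps0
  (decaying_of_contraction delta01 rho01 contr_h) def).
Unshelve. all: by end_near. Qed.
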